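(* Let $\mu$ be a generalized regular, self-similar measure on $\mathbb{R}$ that satisfies the weak separation condition and has support $[0,1]$. Then $$\dim_{qA}\mu=\max\{\overline{\dim}_{\mathrm{loc}}\,\mu(x):x\in\operatorname{supp}\mu\}.$$ In particular, this is true for every equicontractive, regular self-similar measure $\mu$ that satisfies the weak separation condition and has support $[0,1]$.
   Context: $B(x,r)$ denotes the ball of centre $x$ and radius $r$. Self-similar measures. An iterated function system (IFS) is a finite set $\{S_j\}_{j=0}^{m-1}$ of (pairwise distinct) maps $S_j(x)=r_jx+d_j$ on $\mathbb{R}$ with $0<r_j<1$, $d_j\in\mathbb{R}$. Its attractor is the unique non-empty compact set $F$ with $F=\bigcup_j S_j(F)$; here $F=[0,1]$, and the maps are labelled so that $S_0(0)=0$ and $S_{m-1}(1)=1$. Given probabilities $p_j>0$, $\sum_j p_j=1$, the associated self-similar measure $\mu$ is the unique Borel probability measure with $\mu(E)=\sum_j p_j\mu(S_j^{-1}(E))$ for all Borel sets $E$; its support is $[0,1]$. Put $\lambda=\min_j r_j$. The system is equicontractive if all $r_j$ are equal. An equicontractive self-similar measure is regular if $p_0=p_{m-1}=\min_j p_j$ (the probabilities of the left-most and right-most contractions are equal and minimal). For a finite word $w=w_1\cdots w_n$ put $S_w=S_{w_1}\circ\cdots\circ S_{w_n}$, $r_w=r_{w_1}\cdots r_{w_n}$, $p_w=p_{w_1}\cdots p_{w_n}$, $w^-=w_1\cdots w_{n-1}$. For $n\ge 1$, $\Lambda_n$ is the set of finite words $u$ with $r_u\leq\lambda^n$ and $r_{u^-}>\lambda^n$;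 $\Lambda_0$ consists of the empty word. Weak separation condition (WSC). There is $a>0$ such that for all $n\ge1$, all $u,w\in\Lambda_n$ and each $z\in\{0,1\}$: if $S_u(z)\neq S_w(z)$ then $|S_u(z)-S_w(z)|\geq a\lambda^n$. Net intervals. For $n\ge1$ let $h_1<\dots<h_{s_n}$ be the elements of $\{S_u(0),S_u(1):u\in\Lambda_n\}$; the net intervals of level $n$ are $[h_j,h_{j+1}]$, $1\le j\le s_n-1$, forming the set $\mathcal F_n$; $[0,1]$ is the unique net interval of level $0$. $\Delta_n(x)$ denotes a net interval of level $n$ containing $x$ (chosen arbitrarily if there are two). For a net interval $\Delta$ of level $n$ put $P_n(\Delta)=\sum_{u\in\Lambda_n,\,S_u[0,1]\supseteq\Delta}p_u$. Generalized regular. Let $\Delta\in\mathcal F_N$ and let $\Delta'\in\mathcal F_{N+n}$ be contained in $\Delta$. If $u\in\Lambda_N$ with $S_u[0,1]\supseteq\Delta$, and $w$ is a word with $uw\in\Lambda_{N+n}$ and $S_{uw}[0,1]\supseteq\Delta'$, then $w$ is called a path of level $n$ of $\Delta$. It is a left-edge path if $S_w(0)=0$ and a right-edge path if $S_w(1)=1$. Let $\Gamma^L_{\Delta,n}$ (resp. $\Gamma^R_{\Delta,n}$) be the sum of $p_w$ over all left-edge (resp. right-edge) paths $w$ of $\Delta$ of level $n$, and $\Gamma_{\Delta,n}=\Gamma^L_{\Delta,n}+\Gamma^R_{\Delta,n}$. For $n\geq1$ and $x\in[0,1]$ let $$Q_n(x)=\sup_{N\in\mathbb N}\frac{P_N(\Delta_N(x))}{P_{N+n}(\Delta_{N+n}(x))},$$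 where $\Delta_{N+n}(x)$ is a net interval of level $N+n$ contained in $\Delta_N(x)$ and containing $x$ (with $P_{N+n}(\Delta_{N+n}(x))$ minimal if there are two choices), and let $Q_n=\sup_{x\in\operatorname{supp}\mu}Q_n(x)$. The measure $\mu$ (or its weighted IFS) is generalized regular if for each $q>1$, $\lim_{n\to\infty}Q_nq^{-n}\sup_\Delta\Gamma_{\Delta,n}=0$, the supremum being over all net intervals $\Delta$. Dimensions. $\overline{\dim}_{\mathrm{loc}}\,\mu(x)=\limsup_{r\to0}\frac{\log\mu(B(x,r))}{\log r}$ for $x\in\operatorname{supp}\mu$. For $\delta\ge0$ let $H(\delta)$ be the infimum of all $s$ for which there exist $C_1,C_2>0$ such that for all $0<r\leq R^{1+\delta}\leq R\leq C_1$, $\sup_{x\in\operatorname{supp}\mu}\frac{\mu(B(x,R))}{\mu(B(x,r))}\leq C_2(R/r)^s$. Then $\dim_{qA}\mu=\lim_{\delta\to0}H(\delta)$. *)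

(* Defs.v *)
From HB Require Import structures.
From mathcomp Require Import all_boot all_order all_algebra.
From mathcomp Require Import all_classical all_reals all_analysis.
Set Implicit Arguments.
Unset Strict Implicit.
Unset Printing Implicit Defensive.
Import Order.TTheory GRing.Theory Num.Theory.
Import numFieldNormedType.Exports.
Local Open Scope classical_set_scope.
Local Open Scope ring_scope.

Definition family_min (R : realType) (m : nat) (f : 'I_m.+1 -> R) : R :=
  \big[Num.min/f ord0]_(j < m.+1) f j.

(* A weighted IFS on the line with m.+1 maps, indexed by 0, ..., m. *)
Record weighted_ifs (R : realType) (m : nat) := WeightedIFS {
  ratio : 'I_m.+1 -> R;
  translation : 'I_m.+1 -> R;
  weight : 'I_m.+1 -> R;
  ratio_gt0 : forall j, 0 < ratio j;
  ratio_lt1 : forall j, ratio j < 1;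
  maps_distinct :
    injective (fun j (x : R) => ratio j * x + translation j);
  weight_gt0 : forall j, 0 < weight j;
  weight_sum1 : \sum_(j < m.+1) weight j = 1
}.

Section IteratedFunctionSystem.
Context {R : realType} {m : nat}.
Variable I : weighted_ifs R m.
Implicit Types (u w : seq 'I_m.+1) (n N : nat) (D : R * R).

Definition ifs_map (j : 'I_m.+1) (x : R) : R :=
  ratio I j * x + translation I j.

Definition is_attractor (F : set R) : Prop :=
  [/\ F !=set0, compact F & F = \bigcup_j (ifs_map j @` F)].

Definition min_ratio : R := family_min (ratio I).

Definition equicontractive : Prop := forall i j, ratio I i = ratio I j.

Definition regular : Prop :=
  weight I ord0 = family_min (weight I) /\
  weight I ord_max = family_min (weight I).

Definition word_map w (x : R) : R := foldr ifs_map x w.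
Definition word_ratio w : R := \prod_(j <- w) ratio I j.
Definition word_weight w : R := \prod_(j <- w) weight I j.

(* [take (size u).-1 u] is u without its last letter. Since all ratios are < 1,
   each [Lambda n] is finite, so the [\sum_(_ \in _)] below are genuine sums. *)
Definition Lambda n : set (seq 'I_m.+1) :=
  if n is 0 then [set [::]]
  else [set u | word_ratio u <= min_ratio ^+ n /\
                min_ratio ^+ n < word_ratio (take (size u).-1 u)].

Definition cylinder w : set R := word_map w @` `[0, 1]%classic.

Definition weak_separation : Prop :=
  exists2 a : R, 0 < a &
    forall n u w (z : R), (0 < n)%N -> Lambda n u -> Lambda n w ->
      z = 0 \/ z = 1 -> word_map u z <> word_map w z ->
      a * min_ratio ^+ n <= `|word_map u z - word_map w z|.

Definition level_endpoints n : set R :=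
  [set h | exists2 u, Lambda n u & h = word_map u 0 \/ h = word_map u 1].

(* A compact interval is represented by the pair of its end points. For n = 0
   this gives the single interval [0, 1]. *)
Definition net_interval n D : Prop :=
  [/\ level_endpoints n D.1, level_endpoints n D.2, D.1 < D.2 &
      forall h, level_endpoints n h -> ~ (D.1 < h /\ h < D.2)].

Definition interval_of D : set R := `[D.1, D.2]%classic.

Definition net_weight n D : R :=
  \sum_(u \in [set u | Lambda n u /\ interval_of D `<=` cylinder u])
    word_weight u.

(* w is a path of level n of D, where D is a net interval of level N. *)
Definition is_path N D n w : Prop :=
  exists u D',
    [/\ net_interval (N + n) D', interval_of D' `<=` interval_of D,
        Lambda N u /\ interval_of D `<=` cylinder u,
        Lambda (N + n) (u ++ w) & interval_of D' `<=` cylinder (u ++ w)].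

Definition left_edge_weight N D n : R :=
  \sum_(w \in [set w | is_path N D n w /\ word_map w 0 = 0]) word_weight w.

Definition right_edge_weight N D n : R :=
  \sum_(w \in [set w | is_path N D n w /\ word_map w 1 = 1]) word_weight w.

Definition edge_weight N D n : R :=
  left_edge_weight N D n + right_edge_weight N D n.

Definition sup_edge_weight n : \bar R :=
  ereal_sup [set y | exists N D,
    net_interval N D /\ y = (edge_weight N D n)%:E].

(* At a common end point x of two net intervals of level N, both choices of D
   contribute to the supremum; D' is a net interval of level N + n with
   x \in D' `<=` D of minimal [net_weight]. After taking the supremum over x the
   convention is immaterial, every pair D' `<=` D being realised at an interior
   point of D'. *)
Definition Q_at (x : R) n : \bar R :=
  ereal_sup [set y | exists N D D',
    [/\ net_interval N D /\ interval_of D x,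
        net_interval (N + n) D' /\ interval_of D' x,
        interval_of D' `<=` interval_of D,
        (forall D'', net_interval (N + n) D'' -> interval_of D'' x ->
           interval_of D'' `<=` interval_of D ->
           net_weight (N + n) D' <= net_weight (N + n) D'') &
        y = (net_weight N D / net_weight (N + n) D')%:E]].

Definition self_similar (mu : probability (measurableTypeR R) R) : Prop :=
  forall E : set (measurableTypeR R), measurable E ->
    mu E = (\sum_(j < m.+1) (weight I j)%:E * mu (ifs_map j @^-1` E))%E.

End IteratedFunctionSystem.

Section Dimensions.
Context {R : realType}.
Variable mu : probability (measurableTypeR R) R.

Definition ball_mass (x r : R) : R := fine (mu (ball x r)).

Definition supp : set R := [set x | forall r : R, 0 < r -> 0 < ball_mass x r].

Definition upper_local_dim (x : R) : \bar R :=
  limf_esup (fun r : R => (ln (ball_mass x r) / ln r)%:E) (0^'+).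

Definition assouad_exponent (delta : R) : \bar R :=
  ereal_inf [set s%:E | s in [set s : R |
    exists C1 C2 : R, [/\ 0 < C1, 0 < C2 &
      forall r rho : R, 0 < r -> r <= rho `^ (1 + delta) ->
        rho `^ (1 + delta) <= rho -> rho <= C1 ->
        (ereal_sup [set (ball_mass x rho / ball_mass x r)%:E | x in supp]
           <= (C2 * (rho / r) `^ s)%:E)%E]]].

(* The limit exists because [assouad_exponent] is nonincreasing. *)
Definition quasi_assouad_dim : \bar R :=
  lim (assouad_exponent delta @[delta --> 0^'+]).

End Dimensions.

Definition Q_sup {R : realType} {m : nat} (I : weighted_ifs R m)
    (mu : probability (measurableTypeR R) R) (n : nat) : \bar R :=
  ereal_sup [set Q_at I x n | x in supp mu].

Definition generalized_regular {R : realType} {m : nat}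
    (I : weighted_ifs R m) (mu : probability (measurableTypeR R) R) : Prop :=
  forall q : R, 1 < q ->
    (Q_sup I mu n * (q ^- n)%:E * sup_edge_weight I n)%E @[n --> \oo] --> 0%E.

Definition is_maximum {d} {T : porderType d} (A : set T) (a : T) : Prop :=
  A a /\ ubound A a.

(* Main.v *)
(* Write l for the minimal ratio, P_N(D) for the cover weight of a net interval
   D of level N, and e_n for the total weight of the words of level n whose
   interval starts at 0. These words are left-edge paths of [0, 1], so
   generalized regularity bounds P_N(D) / P_(N+n)(D') by q^n / e_n for all q > 1
   and large n, while the weak separation condition gives mu(B(0, a l^n)) <= e_n.
   Hence the local dimension at 0 already dominates every ratio
   P_N(D) / P_(N+n)(D').

   To pass to balls one compares neighbouring net intervals of level N: a word
   covering one of them and not the other ends at the common end point h, and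
   after the first level at which it ends at h it continues along an edge path.
   The same bound on edge weights shows that the two cover weights differ by a
   factor at most C q^(2N), which is negligible because the quasi-Assouad
   dimension only involves scales with n >= delta N. So the exponent for each
   delta > 0 equals the upper local dimension at 0, where the maximum is attained.

   In the regular equicontractive case the only edge paths are powers of the
   first or last letter, of weight min p^n, and P_N(D) <= (min p)^-n P_(N+n)(D'). *)
Require Import Defs.
From HB Require Import structures.
From mathcomp Require Import all_boot all_order all_algebra.
From mathcomp Require Import all_classical all_reals all_analysis.
From mathcomp Require Import measurable_realfun.
From mathcomp Require Import ring lra zify.
Set Implicit Arguments.
Unset Strict Implicit.
Unset Printing Implicit Defensive.
Import Order.TTheory GRing.Theory Num.Theory.
Import numFieldNormedType.Exports.
Local Open Scope classical_set_scope.
Local Open Scope ring_scope.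

(** * Words stopped when their ratio drops below a threshold, and weighted sums over them *)

Section StoppedWords.
Context {R : realType} {m : nat}.
Variable I : weighted_ifs R m.
Implicit Types (t s : R) (u v w : seq 'I_m.+1) (g f : seq 'I_m.+1 -> R).
Local Notation r := (Defs.ratio I).
Local Notation p := (weight I).
Local Notation rw := (word_ratio I).
Local Notation pw := (word_weight I).
Local Notation lam := (min_ratio I).

Lemma word_ratio_nil : rw [::] = 1. Proof. by rewrite /word_ratio big_nil. Qed.
Lemma word_ratio_cons j w : rw (j :: w) = r j * rw w.
Proof. by rewrite /word_ratio big_cons. Qed.
Lemma word_ratio_cat u w : rw (u ++ w) = rw u * rw w.
Proof. by rewrite /word_ratio big_cat. Qed.
Lemma word_weight_nil : pw [::] = 1. Proof. by rewrite /word_weight big_nil. Qed.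
Lemma word_weight_cons j w : pw (j :: w) = p j * pw w.
Proof. by rewrite /word_weight big_cons. Qed.
Lemma word_ratio_gt0 w : 0 < rw w.
Proof. by apply: prodr_gt0 => j _; exact: ratio_gt0. Qed.
Lemma word_weight_gt0 w : 0 < pw w.
Proof. by apply: prodr_gt0 => j _; exact: weight_gt0. Qed.
Lemma word_ratio_le1 w : rw w <= 1.
Proof.
elim: w => [|j w ih]; first by rewrite word_ratio_nil.
rewrite word_ratio_cons; apply: mulr_ile1 => //; try exact/ltW/ratio_gt0.
  exact/ltW/word_ratio_gt0.
exact/ltW/ratio_lt1.
Qed.

Lemma family_min_le (f : 'I_m.+1 -> R) j : family_min f <= f j.
Proof. exact: bigmin_le_cond. Qed.

Lemma family_min_ex (f : 'I_m.+1 -> R) : exists j, family_min f = f j.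
Proof.
rewrite /family_min; apply: (@big_ind _ (fun x => exists j, x = f j)).
- by exists ord0.
- move=> x y [i ->] [j ->]; case: (leP (f i) (f j)) => _; by [exists i|exists j].
- by move=> i _; exists i.
Qed.

Lemma min_ratio_gt0 : 0 < lam.
Proof. rewrite /min_ratio; have [j ->] := family_min_ex r; exact: ratio_gt0. Qed.
Lemma min_ratio_lt1 : lam < 1.
Proof. rewrite /min_ratio; have [j ->] := family_min_ex r; exact: ratio_lt1. Qed.
Lemma min_ratio_exp_gt0 n : 0 < lam ^+ n.
Proof. exact/exprn_gt0/min_ratio_gt0. Qed.

Lemma max_ratio_ex : exists rho, [/\ 0 < rho, rho < 1 & forall j, r j <= rho].
Proof.
have [j] : exists j, forall i, r i <= r j.
  have [j _ jP] := @arg_maxP _ _ _ ord0 predT r isT.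
  by exists j => i; exact: jP.
by move=> jP; exists (r j); split => //; [exact: ratio_gt0|exact: ratio_lt1].
Qed.

Lemma exp_le_eps (x e : R) : 0 <= x -> x < 1 -> 0 < e -> exists k, x ^+ k <= e.
Proof.
move=> x0 x1 e0.
have /cvgrPdist_lt/(_ _ e0) [k _ kP] := @cvg_expr R x ltac:(by rewrite ger0_norm).
exists k; have := kP k (leqnn k); rewrite /= sub0r normrN => /ltW.
by apply: le_trans; rewrite ler_norm.
Qed.

(* Induction along the tree of words: a node with budget t >= 1 is a leaf, and
   the j-th child of a node with budget t has budget t / r_j. *)
Lemma stop_ind (P : R -> Prop) :
  (forall t, 1 <= t -> P t) ->
  (forall t, 0 < t -> t < 1 -> (forall j, P (t / r j)) -> P t) ->
  forall t, 0 < t -> P t.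
Proof.
move=> P1 PS t t0.
have [rho [rho0 rho1 rP]] := max_ratio_ex.
have [k] := exp_le_eps (ltW rho0) rho1 t0.
elim: k t t0 => [|k ih] t t0; first by rewrite expr0; exact: P1.
move=> tk; have [/P1//|t1] := leP 1 t.
apply: PS => // j; apply: ih; first by rewrite divr_gt0 // ratio_gt0.
rewrite ler_pdivlMr ?ratio_gt0//; apply: le_trans tk.
by rewrite exprSr ler_wpM2l ?exprn_ge0 // ltW.
Qed.

(* w is a leaf of the tree with budget t at the root. *)
Fixpoint stopb t w : bool :=
  if 1 <= t then w == [::] else if w is j :: w' then stopb (t / r j) w' else false.

Lemma stopb_ge1 t w : 1 <= t -> stopb t w = (w == [::]).
Proof. by case: w => [|j w] /= ->. Qed.

Lemma stopb_lt1 t : t < 1 -> (stopb t [::] = false) *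
   (forall j w, stopb t (j :: w) = stopb (t / r j) w).
Proof. by rewrite ltNge => /negbTE t1; split => [|j w] /=; rewrite t1. Qed.

(** Both inequalities divide by the ratio of the first letter [j], which turns t into t / r_j. If t
    / r_j >= 1 the tail must be empty, since otherwise the word without its last letter has ratio at
    most r_j <= t. *)
Lemma stopb_ratioP t w : t < 1 ->
  reflect (rw w <= t /\ t < rw (take (size w).-1 w)) (stopb t w).
Proof.
elim: w t => [|j w ih] t t1.
  rewrite (stopb_lt1 t1); constructor; rewrite word_ratio_nil => -[].
  by rewrite leNgt t1.
have rj := ratio_gt0 I j.
rewrite (stopb_lt1 t1) word_ratio_cons; apply: (iffP idP).
  have [t1'|t1'] := leP 1 (t / r j).
    rewrite stopb_ge1// => /eqP ->; rewrite /= word_ratio_nil mulr1; split => //.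
    by move: t1'; rewrite ler_pdivlMr// mul1r.
  case/(ih _ t1') => h1 h2; split; first by rewrite mulrC -ler_pdivlMr.
  case: w ih h1 h2 => [|k w] ih h1 h2.
    by rewrite word_ratio_nil in h1; move: (le_lt_trans h1 t1'); rewrite ltxx.
  by move: h2; rewrite ltr_pdivrMr// mulrC -word_ratio_cons.
have [t1'|t1'] := leP 1 (t / r j).
  rewrite stopb_ge1//; case: w {ih} => // k w [_].
  rewrite (_ : take _ _ = j :: take (size w) (k :: w))// word_ratio_cons.
  move: t1'; rewrite ler_pdivlMr// mul1r => /le_lt_trans/[apply].
  by rewrite ltNge -{2}[r j]mulr1 ler_pM2l// word_ratio_le1.
case: w ih => [|k w] ih [h1 h2].
  by move: t1'; rewrite ltr_pdivrMr// mul1r ltNge -[r j]mulr1 -word_ratio_nil h1.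
apply/(ih _ t1'); rewrite ler_pdivlMr// mulrC; split => //.
by rewrite ltr_pdivrMr// mulrC -word_ratio_cons.
Qed.

Lemma LambdaE n : Lambda I n = [set u | stopb (lam ^+ n) u].
Proof.
apply/seteqP; case: n => [|n]; split => u.
- by move=> ->; rewrite /= expr0 lexx.
- by rewrite /= expr0 stopb_ge1// => /eqP.
- by move=> h; apply/stopb_ratioP => //; rewrite exprn_ilt1// ?min_ratio_lt1// ltW// min_ratio_gt0.
- by move/stopb_ratioP; apply; rewrite exprn_ilt1// ?min_ratio_lt1// ltW// min_ratio_gt0.
Qed.

Lemma stopb_ratio_le t u : stopb t u -> rw u <= t.
Proof.
have [t1|t1] := leP 1 t; last by case/stopb_ratioP.
by rewrite stopb_ge1// => /eqP ->; rewrite word_ratio_nil.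
Qed.

(** No word is stopped earlier by a smaller budget, so the tree for s contains every leaf u of the
    tree for t; below u it is again such a tree, with the rescaled budget s / r_u. *)
Lemma stopb_cat t s u w : s <= t -> stopb t u ->
  stopb s (u ++ w) = stopb (s / rw u) w.
Proof.
elim: u t s => [|j u ih] t s st; first by rewrite word_ratio_nil divr1.
have rj := ratio_gt0 I j.
have [t1|t1] := leP 1 t; first by rewrite stopb_ge1.
rewrite (stopb_lt1 t1) cat_cons (stopb_lt1 (le_lt_trans st t1)) => /ih ->.
  by rewrite word_ratio_cons -mulrA -invfM.
by rewrite ler_pM2r ?invr_gt0.
Qed.

Lemma stops_ex t : 0 < t -> exists l : seq (seq 'I_m.+1), uniq l /\ forall w, (w \in l) = stopb t w.
Proof.
elim/stop_ind => {}t.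
  by move=> t1; exists [:: [::]]; split => // w; rewrite inE stopb_ge1.
move=> t0 t1 /choice[l lP].
exists [seq j :: w | j <- index_enum 'I_m.+1, w <- l j]; split.
  apply: allpairs_uniq_dep.
  - exact: index_enum_uniq.
  - by move=> j _; case: (lP j).
  - by move=> [i x] [j y] _ _ /= [-> ->].
move=> w; apply/allpairsPdep/idP.
  by move=> [j [x [_ xl ->]]]; rewrite (stopb_lt1 t1); case: (lP j) => _ <-.
case: w => [|j w]; rewrite (stopb_lt1 t1)// => h.
by exists j, w; rewrite mem_index_enum; split => //; case: (lP j) => _ ->.
Qed.

(** The list is chosen classically because the recursion from t to t / r_j is not structural; only
    its members matter, not their order. *)
Definition stops t : seq (seq 'I_m.+1) := xget [::] [set l | uniq l /\ forall w, (w \in l) = stopb t w].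

Lemma stopsP t : 0 < t -> uniq (stops t) /\ (forall w, (w \in stops t) = stopb t w).
Proof. by move=> /stops_ex [l lP]; rewrite /stops; case: xgetP => [_ -> //|/(_ l)]. Qed.

Lemma mem_stops t w : 0 < t -> (w \in stops t) = stopb t w.
Proof. by case/stopsP => _ ->. Qed.

(* The expectation of g at the word stopped when its ratio drops below t. *)
Definition stopE t g : R := \sum_(w <- stops t) pw w * g w.

Lemma stopE_ge1 t g : 1 <= t -> stopE t g = g [::].
Proof.
move=> t1; have t0 : 0 < t by exact: lt_le_trans t1.
rewrite /stopE (perm_big [:: [::]]) /=.
  by rewrite big_seq1 word_weight_nil mul1r.
by apply: uniq_perm; rewrite ?(stopsP t0).1// => w; rewrite mem_stops// stopb_ge1// inE.
Qed.

Lemma stopE_lt1 t g : 0 < t -> t < 1 ->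
  stopE t g = \sum_j p j * stopE (t / r j) (fun w => g (j :: w)).
Proof.
move=> t0 t1; have tj j : 0 < t / r j by rewrite divr_gt0 ?ratio_gt0.
rewrite /stopE (perm_big [seq j :: w | j <- index_enum 'I_m.+1, w <- stops (t / r j)]) /=.
  rewrite big_allpairs_dep /=; apply: eq_bigr => j _.
  by rewrite mulr_sumr; apply: eq_bigr => w _; rewrite word_weight_cons mulrA.
apply: uniq_perm; first exact: (stopsP t0).1.
  apply: allpairs_uniq_dep.
  - exact: index_enum_uniq.
  - by move=> j _; exact: (stopsP (tj j)).1.
  - by move=> [i x] [j y] _ _ /= [-> ->].
move=> w; rewrite mem_stops//; apply/idP/allpairsPdep.
  case: w => [|j w]; rewrite (stopb_lt1 t1)// => h.
  by exists j, w; rewrite mem_index_enum mem_stops.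
by move=> [j [x [_ xl ->]]]; rewrite (stopb_lt1 t1) -mem_stops.
Qed.

Lemma ler_stopE t g f : 0 < t -> (forall w, stopb t w -> g w <= f w) ->
  stopE t g <= stopE t f.
Proof.
move=> t0 h; rewrite /stopE big_seq [leRHS]big_seq; apply: ler_sum => w.
by rewrite mem_stops// => /h; apply: ler_wpM2l; exact/ltW/word_weight_gt0.
Qed.

Lemma eq_stopE t g f : 0 < t -> (forall w, stopb t w -> g w = f w) ->
  stopE t g = stopE t f.
Proof. by move=> t0 h; apply/eqP; rewrite eq_le !ler_stopE// => w /h ->. Qed.

Lemma stopE_cst t (c : R) : 0 < t -> stopE t (fun=> c) = c.
Proof.
elim/stop_ind => {}t; first by move=> t1; rewrite stopE_ge1.
move=> t0 t1 ih; rewrite stopE_lt1// (eq_bigr (fun j => p j * c)).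
  by rewrite -mulr_suml weight_sum1 mul1r.
by move=> j _; rewrite ih.
Qed.

Lemma stopED t g f : stopE t (fun w => g w + f w) = stopE t g + stopE t f.
Proof. by rewrite /stopE -big_split; apply: eq_bigr => w _; rewrite /= mulrDr. Qed.

Lemma stopEZ t (c : R) f : stopE t (fun w => c * f w) = c * stopE t f.
Proof. by rewrite /stopE mulr_sumr; apply: eq_bigr => w _; rewrite mulrCA. Qed.

Lemma stopE_sum t (J : Type) (l : seq J) (f : J -> seq 'I_m.+1 -> R) :
  stopE t (fun w => \sum_(j <- l) f j w) = \sum_(j <- l) stopE t (f j).
Proof. by rewrite /stopE exchange_big /=; apply: eq_bigr => w _; rewrite mulr_sumr. Qed.

Lemma stopE_ge0 t g : 0 < t -> (forall w, stopb t w -> 0 <= g w) -> 0 <= stopE t g.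
Proof. by move=> t0 h; rewrite -(stopE_cst 0 t0); exact: ler_stopE. Qed.

(** This is the strong Markov property for letters drawn independently with the given weights:
    stopping at s amounts to stopping at t first and restarting. Both sides obey the same
    first-letter recursion. *)
Lemma stopE_markov t s g : 0 < s -> s <= t ->
  stopE s g = stopE t (fun u => stopE (s / rw u) (fun w => g (u ++ w))).
Proof.
move=> s0 st; have t0 := lt_le_trans s0 st.
elim/stop_ind: t / t0 s s0 st g => t.
  by move=> t1 s s0 st g; rewrite [RHS]stopE_ge1// word_ratio_nil divr1.
move=> t0 t1 ih s s0 st g.
rewrite stopE_lt1 ?(le_lt_trans st)// [RHS]stopE_lt1//; apply: eq_bigr => j _.
have rj := ratio_gt0 I j.
rewrite (ih j) ?divr_gt0 ?ler_pM2r ?invr_gt0//; congr (_ * _).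
by apply: eq_stopE => [|w _]; rewrite ?divr_gt0// word_ratio_cons invfM mulrA.
Qed.

Lemma stopE_ge_word t g w : 0 < t -> (forall v, stopb t v -> 0 <= g v) ->
  stopb t w -> pw w * g w <= stopE t g.
Proof.
move=> t0 g0 tw; rewrite /stopE (bigD1_seq w) ?mem_stops ?(stopsP t0).1//=.
rewrite lerDl big_seq_cond; apply: sumr_ge0 => v /andP[+ _].
by rewrite mem_stops// => /g0; apply: mulr_ge0; exact/ltW/word_weight_gt0.
Qed.

Lemma fsum_stopE t (Q : set (seq 'I_m.+1)) : 0 < t ->
  \sum_(w \in [set w | stopb t w /\ Q w]) pw w = stopE t (fun w => (`[<Q w>])%:R).
Proof.
move=> t0; rewrite /stopE.
rewrite (_ : [set w | _] = [set` [seq w <- stops t | `[<Q w>]]]).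
  rewrite -fsbig_seq ?filter_uniq ?(stopsP t0).1// big_filter big_mkcond.
  by apply: eq_bigr => w _; case: ifP; rewrite ?mulr1 ?mulr0.
apply/seteqP; split => w /=; rewrite mem_filter mem_stops//.
  by move=> [-> ?]; rewrite andbT; apply/asboolP.
by move=> /andP[/asboolP].
Qed.

(** Every path is a suffix of one of the finitely many words of level N + n. Finiteness matters
    because a sum over an infinite support defaults to 0. *)
Lemma stopb_path_finite N n (A : set (seq 'I_m.+1)) :
  (forall w, A w -> exists2 u, Lambda I N u & Lambda I (N + n) (u ++ w)) ->
  finite_set A.
Proof.
move=> h; pose l := [seq drop k v | v <- stops (lam ^+ (N + n)), k <- iota 0 (size v).+1].
apply: (@sub_finite_set _ _ [set` l]); last exact: finite_seq.
move=> w /h[u _]; rewrite LambdaE /= => uw.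
apply/allpairsPdep; exists (u ++ w), (size u).
rewrite mem_stops ?min_ratio_exp_gt0// mem_iota size_cat drop_size_cat//; split => //.
by rewrite add0n ltnS leq_addr.
Qed.

Lemma le_stopE_fsum t (Q B : set (seq 'I_m.+1)) : 0 < t -> finite_set B ->
  (forall w, stopb t w -> Q w -> B w) ->
  stopE t (fun w => (`[<Q w>])%:R) <= \sum_(w \in B) pw w.
Proof.
move=> t0 fB QB; rewrite -fsum_stopE//.
rewrite [leRHS](fsbigID [set w | stopb t w /\ Q w])//.
rewrite (_ : B `&` _ = [set w | stopb t w /\ Q w]).
  by rewrite lerDl fsumr_ge0// => w _; exact/ltW/word_weight_gt0.
by apply/seteqP; split => w /= => [[]//|[? ?]]; split => //; exact: QB.
Qed.

End StoppedWords.

(** * Net intervals, cover weights and edge paths *)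

Lemma finite_set_has_max (R : realType) (A : set R) : finite_set A -> A !=set0 ->
  exists2 x, A x & forall y, A y -> y <= x.
Proof.
move=> /finite_seqP[s ->]; elim: s => [[x]//|a s ih _].
have [[|b s'] sE] := ex_intro (fun l => s = l) s erefl.
  by exists a; rewrite /= ?sE ?inE// => y; rewrite inE => /eqP ->.
have [|x xs xP] := ih; first by exists b; rewrite /= sE mem_head.
have [ax|ax] := leP a x.
  exists x; rewrite /= ?inE ?xs ?orbT// => y; rewrite inE => /orP[/eqP ->//|].
  exact: xP.
exists a; rewrite /= ?mem_head// => y; rewrite inE => /orP[/eqP ->//|/xP yx].
exact: le_trans yx (ltW ax).
Qed.

Lemma finite_set_has_min (R : realType) (A : set R) : finite_set A -> A !=set0 ->
  exists2 x, A x & forall y, A y -> x <= y.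
Proof.
move=> fA [a Aa].
have [| |x [y Ay <-] yP] := @finite_set_has_max R (-%R @` A).
- exact: finite_image.
- by exists (- a), a.
- by exists y => // z Az; rewrite -lerN2; apply: yP; exists z.
Qed.

Section NetIntervals.
Context {R : realType} {m : nat}.
Variable I : weighted_ifs R m.
Implicit Types (t s x : R) (u v w : seq 'I_m.+1) (D : R * R).
Local Notation r := (Defs.ratio I).
Local Notation rw := (word_ratio I).
Local Notation pw := (word_weight I).
Local Notation lam := (min_ratio I).
Local Notation S := (word_map I).
Local Notation E := (stopE I).

Lemma word_map_affine w x : S w x = rw w * x + S w 0.
Proof.
elim: w => [|j w ih] /=; first by rewrite word_ratio_nil mul1r addr0.
by rewrite /ifs_map ih word_ratio_cons; ring.
Qed.

Lemma word_map1 w : S w 1 = S w 0 + rw w.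
Proof. by rewrite word_map_affine mulr1 addrC. Qed.

Lemma word_map_lt w : S w 0 < S w 1.
Proof. by rewrite word_map1 ltrDl word_ratio_gt0. Qed.

Lemma word_map_cat u w x : S (u ++ w) x = S u (S w x).
Proof. by rewrite /word_map foldr_cat. Qed.

Lemma word_map_inj w : injective (S w).
Proof.
move=> x y; rewrite (word_map_affine w x) (word_map_affine w y) => /addIr/mulfI -> //.
exact/lt0r_neq0/word_ratio_gt0.
Qed.

Lemma word_map_le w x y : x <= y -> S w x <= S w y.
Proof.
by move=> xy; rewrite (word_map_affine w x) (word_map_affine w y) lerD2r ler_wpM2l// ltW// word_ratio_gt0.
Qed.

Definition covers u D := (S u 0 <= D.1) && (D.2 <= S u 1).

Lemma cylinderE u : cylinder I u = `[S u 0, S u 1]%classic.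
Proof.
apply/seteqP; split => x; rewrite /cylinder /= ?in_itv/=.
  by move=> [y]; rewrite in_itv/= => /andP[y0 y1] <-; rewrite !word_map_le.
rewrite word_map1 => /andP[x0 x1]; have r0 := word_ratio_gt0 I u.
exists ((x - S u 0) / rw u).
  by rewrite in_itv/= ler_pdivrMr// ler_pdivlMr// mul1r mul0r lerBlDl subr_ge0 x0.
by rewrite word_map_affine mulrC divfK ?gt_eqF// subrK.
Qed.

Lemma coversP u D : D.1 <= D.2 -> (interval_of D `<=` cylinder I u) <-> covers u D.
Proof.
move=> D12; rewrite cylinderE /interval_of; split.
  move=> h; have /= := h D.1; have /= := h D.2; rewrite !in_itv/= D12 !lexx/=.
  by move=> /(_ isT)/andP[_ h2] /(_ isT)/andP[h1 _]; rewrite /covers h1.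
move=> /andP[h1 h2] x; rewrite /= !in_itv/= => /andP[x1 x2].
by rewrite (le_trans h1)// (le_trans x2).
Qed.

Lemma interval_sub D D' : D'.1 <= D'.2 ->
  (interval_of D' `<=` interval_of D) <-> (D.1 <= D'.1 /\ D'.2 <= D.2).
Proof.
move=> D12; rewrite /interval_of; split.
  move=> h; have /= := h D'.1; have /= := h D'.2; rewrite !in_itv/= D12 !lexx/=.
  by move=> /(_ isT)/andP[_ h2] /(_ isT)/andP[h1 _].
move=> [h1 h2] x; rewrite /= !in_itv/= => /andP[x1 x2].
by rewrite (le_trans h1)// (le_trans x2).
Qed.

(** This is P_n(D) for a net interval of level n. It is also evaluated at net intervals of deeper
    levels, where it equals P_n of the ancestor of level n; this allows all levels to be compared
    over one fixed D. *)
Definition cover_weight n D := E (lam ^+ n) (fun u => (covers u D)%:R).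

Lemma net_weightE n D : D.1 <= D.2 -> net_weight I n D = cover_weight n D.
Proof.
move=> D12; rewrite /net_weight LambdaE fsum_stopE ?min_ratio_exp_gt0//.
apply: eq_stopE; rewrite ?min_ratio_exp_gt0// => w _; congr (_%:R).
by congr nat_of_bool; apply/asboolP/idP => /coversP; apply.
Qed.

Lemma cover_weight_ge0 n D : 0 <= cover_weight n D.
Proof. by apply: stopE_ge0; rewrite ?min_ratio_exp_gt0. Qed.

Lemma min_ratio_exp_le N M : (N <= M)%N -> lam ^+ M <= lam ^+ N.
Proof. by move=> NM; apply: ler_wiXn2l => //; rewrite ltW// ?min_ratio_gt0// min_ratio_lt1. Qed.

Lemma stopb_lam_cat N M u w : (N <= M)%N -> stopb I (lam ^+ N) u ->
  stopb I (lam ^+ M) (u ++ w) = stopb I (lam ^+ M / rw u) w.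
Proof. by move=> /min_ratio_exp_le; exact: stopb_cat. Qed.

Lemma lam_div_gt0 n u : 0 < lam ^+ n / rw u.
Proof. by rewrite divr_gt0 ?min_ratio_exp_gt0// word_ratio_gt0. Qed.

Hypothesis att : is_attractor I `[0, 1]%classic.

Lemma ifs_map01 j x : 0 <= x <= 1 -> 0 <= ifs_map I j x <= 1.
Proof.
move=> x01; case: att => _ _ /seteqP[_ /(_ (ifs_map I j x))] /=.
by rewrite in_itv/=; apply; exists j => //; exists x => //=; rewrite in_itv.
Qed.

Lemma word_map01 w x : 0 <= x <= 1 -> 0 <= S w x <= 1.
Proof. by move=> x01; elim: w => //= j w ih; exact: ifs_map01. Qed.

Lemma covers_cat u w D : covers (u ++ w) D -> covers u D.
Proof.
rewrite /covers !word_map_cat => /andP[h1 h2].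
have /andP[a0 _] := @word_map01 w 0 ltac:(by rewrite lexx ler01).
have /andP[_ b1] := @word_map01 w 1 ltac:(by rewrite lexx ler01).
by rewrite (le_trans _ h1) ?word_map_le//= (le_trans h2)// word_map_le.
Qed.

Lemma cover_weight_markov N M D : (N <= M)%N -> cover_weight M D =
  E (lam ^+ N) (fun u => E (lam ^+ M / rw u) (fun w => (covers (u ++ w) D)%:R)).
Proof.
by move=> NM; exact: (stopE_markov I (fun u => (covers u D)%:R) (min_ratio_exp_gt0 I M) (min_ratio_exp_le NM)).
Qed.

Lemma suffix_weight_le s u D : 0 < s ->
  E s (fun w => (covers (u ++ w) D)%:R) <= (covers u D)%:R.
Proof.
move=> s0; rewrite -[leRHS](@stopE_cst _ _ I s) //.
apply: ler_stopE => // w _.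
by case h : (covers (u ++ w) D); rewrite ?(covers_cat h).
Qed.

Lemma cover_weight_mono N M D : (N <= M)%N -> cover_weight M D <= cover_weight N D.
Proof.
move=> NM; rewrite (cover_weight_markov _ NM).
apply: ler_stopE; rewrite ?min_ratio_exp_gt0// => u _.
exact/suffix_weight_le/lam_div_gt0.
Qed.

(** The attractor equation is applied once at each node of the tree, following a preimage of x
    inside [0, 1]. *)
Lemma stopb_cover_ex t x : 0 < t -> 0 <= x <= 1 ->
  exists w, stopb I t w /\ S w 0 <= x <= S w 1.
Proof.
move=> t0; elim/(stop_ind (I := I)): t / t0 x => t.
  by move=> t1 x x01; exists [::]; rewrite stopb_ge1.
move=> t0 t1 ih x x01.
case: att => _ _ /seteqP[/(_ x) + _]; rewrite /= in_itv/= => /(_ x01)[j _ [y]].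
rewrite /= in_itv/= => /(ih j)[w [wt /andP[w0 w1]]] <-; exists (j :: w).
rewrite (stopb_lt1 I t1) /=; split => //.
by rewrite /ifs_map !lerD2r !ler_pM2l ?ratio_gt0// w0.
Qed.

Hypothesis left_map : ifs_map I ord0 0 = 0.
Hypothesis right_map : ifs_map I ord_max 1 = 1.

Lemma stopb_edge_ex t z : 0 < t -> z = 0 \/ z = 1 ->
  exists w, stopb I t w /\ S w z = z.
Proof.
move=> t0 zP; have [j jP] : exists j, ifs_map I j z = z.
  by case: zP => ->; [exists ord0|exists ord_max].
elim/(stop_ind (I := I)): t / t0 => t; first by move=> t1; exists [::]; rewrite stopb_ge1.
move=> t0 t1 /(_ j)[w [tw wz]]; exists (j :: w).
by rewrite (stopb_lt1 I t1) /= wz.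
Qed.

Lemma endpointP n h : level_endpoints I n h <->
  exists u z, [/\ stopb I (lam ^+ n) u, z = 0 \/ z = 1 & h = S u z].
Proof.
rewrite /level_endpoints LambdaE; split.
  by move=> [u /= uL [->|->]]; [exists u, 0|exists u, 1]; split => //; [left|right].
by move=> [u [z [uL zP ->]]]; exists u => //; case: zP => ->; [left|right].
Qed.

Lemma endpoint_of n u z : stopb I (lam ^+ n) u -> z = 0 \/ z = 1 ->
  level_endpoints I n (S u z).
Proof. by move=> uL zP; apply/endpointP; exists u, z. Qed.

Lemma endpoints_finite n : finite_set (level_endpoints I n).
Proof.
rewrite (_ : level_endpoints I n =
  ((fun u => S u 0) @` [set` stops I (lam ^+ n)]) `|`
  ((fun u => S u 1) @` [set` stops I (lam ^+ n)])).
  by rewrite finite_setU; split; apply: finite_image; exact: finite_seq.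
have e0 := min_ratio_exp_gt0 I n.
apply/seteqP; split => x.
  move/endpointP => [u [z [uL [] -> ->]]]; [left|right]; exists u => //=;
  by rewrite mem_stops.
by case=> -[u /=]; rewrite mem_stops// => uL <-; apply: endpoint_of => //; [left|right].
Qed.

Lemma endpoint01 n h : level_endpoints I n h -> 0 <= h <= 1.
Proof.
by move/endpointP => [u [z [_ [] -> ->]]]; apply: word_map01; rewrite ?lexx ler01.
Qed.

(** A word u of level N is prolonged by a word that fixes z (a power of the first or last letter),
    which leaves S_u(z) unchanged. *)
Lemma endpoint_mono N M h : (N <= M)%N -> level_endpoints I N h -> level_endpoints I M h.
Proof.
move=> NM /endpointP[u [z [uL zP ->]]].
have [w [ws wz]] := stopb_edge_ex (lam_div_gt0 M u) zP.
by rewrite -wz -word_map_cat; apply: endpoint_of => //; rewrite (stopb_lam_cat _ NM).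
Qed.

Lemma endpoint_z n z : z = 0 \/ z = 1 -> level_endpoints I n z.
Proof.
move=> zP; apply: (@endpoint_mono 0) => //; apply/endpointP; exists [::], z.
by rewrite expr0 stopb_ge1.
Qed.

Lemma net_at_right n x : 0 <= x < 1 -> exists D, net_interval I n D /\ D.1 <= x < D.2.
Proof.
move=> /andP[x0 x1].
have [| |a [aE ax] aP] := @finite_set_has_max R (level_endpoints I n `&` [set h | h <= x]).
- exact/finite_setIl/endpoints_finite.
- by exists 0; split => //; apply: endpoint_z; left.
have [| |b [bE bx] bP] := @finite_set_has_min R (level_endpoints I n `&` [set h | x < h]).
- exact/finite_setIl/endpoints_finite.
- by exists 1; split => //; apply: endpoint_z; right.
move: ax bx => /= ax xb; exists (a, b); rewrite /= ax xb; split => //.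
split => //=; first exact: le_lt_trans xb.
move=> h hE [ah hb]; have [hx|xh] := leP h x.
  by have := aP h (conj hE hx); rewrite leNgt ah.
by have := bP h (conj hE xh); rewrite leNgt hb.
Qed.

Lemma net_at_left n x : 0 < x <= 1 -> exists D, net_interval I n D /\ D.1 < x <= D.2.
Proof.
move=> /andP[x0 x1].
have [| |a [aE ax] aP] := @finite_set_has_max R (level_endpoints I n `&` [set h | h < x]).
- exact/finite_setIl/endpoints_finite.
- by exists 0; split => //; apply: endpoint_z; left.
have [| |b [bE bx] bP] := @finite_set_has_min R (level_endpoints I n `&` [set h | x <= h]).
- exact/finite_setIl/endpoints_finite.
- by exists 1; split => //; apply: endpoint_z; right.
move: ax bx => /= ax xb; exists (a, b); rewrite /= ax xb; split => //.
split => //=; first exact: lt_le_trans xb.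
move=> h hE [ah hb]; have [hx|xh] := ltP h x.
  by have := aP h (conj hE hx); rewrite leNgt ah.
by have := bP h (conj hE xh); rewrite leNgt hb.
Qed.

Lemma net_left n D h : net_interval I n D -> level_endpoints I n h -> h < D.2 -> h <= D.1.
Proof. by case=> _ _ _ DP hE hD; rewrite leNgt; apply/negP => Dh; exact: (DP h hE). Qed.

Lemma net_right n D h : net_interval I n D -> level_endpoints I n h -> D.1 < h -> D.2 <= h.
Proof. by case=> _ _ _ DP hE hD; rewrite leNgt; apply/negP => H; exact: (DP h hE). Qed.

Lemma net_lt n D : net_interval I n D -> D.1 < D.2.
Proof. by case. Qed.

Lemma net01 n D : net_interval I n D -> [/\ 0 <= D.1, D.1 <= 1, 0 <= D.2 & D.2 <= 1].
Proof. by case=> /endpoint01/andP[? ?] /endpoint01/andP[? ?]. Qed.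

Lemma net_eq n D D' : net_interval I n D -> net_interval I n D' ->
  D.1 < D'.2 -> D'.1 < D.2 -> D = D'.
Proof.
move=> nD nD' h h'; case: (nD) => a b _ _; case: (nD') => a' b' _ _.
rewrite [D]surjective_pairing [D']surjective_pairing; congr (_, _); apply/le_anti.
  by rewrite (net_left nD' a h) (net_left nD a' h').
by rewrite (net_right nD b' h) (net_right nD' b h').
Qed.

(** A cylinder of level n has its ends among the end points of level n, none of which is interior to
    D; so containing one interior point of D means containing D. *)
Lemma covers_net n D u x : net_interval I n D -> stopb I (lam ^+ n) u ->
  S u 0 <= x -> x <= S u 1 -> D.1 < x < D.2 -> covers u D.
Proof.
move=> nD uL ux xu /andP[Dx xD]; apply/andP; split.
  by apply: (net_left nD); [apply: endpoint_of => //; left|exact: le_lt_trans xD].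
by apply: (net_right nD); [apply: endpoint_of => //; right|exact: lt_le_trans xu].
Qed.

Lemma net_ancestor N M D' : (N <= M)%N -> net_interval I M D' ->
  exists D, [/\ net_interval I N D, D.1 <= D'.1 & D'.2 <= D.2].
Proof.
move=> NM nD'; have [a _ _ b] := net01 nD'; have ab := net_lt nD'.
have [|D [nD /andP[D1 D2]]] := @net_at_right N D'.1; first by rewrite a (lt_le_trans ab).
exists D; split => //; apply: (net_right nD') => //; apply: endpoint_mono NM _.
by case: nD.
Qed.

Lemma net_descendant N M D : (N <= M)%N -> net_interval I N D ->
  exists D', [/\ net_interval I M D', D.1 <= D'.1 & D'.2 <= D.2].
Proof.
move=> NM nD; have [a _ _ b] := net01 nD; have ab := net_lt nD.
have [|D' [nD' /andP[D1 D2]]] := @net_at_right M D.1; first by rewrite a (lt_le_trans ab).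
exists D'; case: (nD) => e1 e2 _ _.
split => //; last by apply: (net_right nD') => //; [apply: endpoint_mono NM _|exact: le_lt_trans ab].
by apply: (net_left nD') => //; apply: endpoint_mono NM _.
Qed.

Lemma covers_sub n D D' u : net_interval I n D -> stopb I (lam ^+ n) u ->
  D.1 <= D'.1 -> D'.2 <= D.2 -> D'.1 < D'.2 -> covers u D' = covers u D.
Proof.
move=> nD uL h1 h2 D12; apply/idP/idP; last first.
  by move=> /andP[a b]; apply/andP; split; [exact: le_trans h1|exact: le_trans b].
move=> /andP[a b]; apply: (covers_net (x := (D'.1 + D'.2) / 2) nD uL); lra.
Qed.

Lemma cover_weight_sub n D D' : net_interval I n D ->
  D.1 <= D'.1 -> D'.2 <= D.2 -> D'.1 < D'.2 -> cover_weight n D' = cover_weight n D.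
Proof.
move=> nD h1 h2 h3; apply: eq_stopE; rewrite ?min_ratio_exp_gt0// => u uL.
by rewrite (covers_sub nD).
Qed.

Lemma net_covered n D : net_interval I n D -> exists2 u, stopb I (lam ^+ n) u & covers u D.
Proof.
move=> nD; have [a _ _ b] := net01 nD; have ab := net_lt nD.
have [|u [uL /andP[u0 u1]]] :=
  @stopb_cover_ex _ ((D.1 + D.2) / 2) (min_ratio_exp_gt0 I n); first lra.
by exists u => //; apply: covers_net nD uL u0 u1 _; lra.
Qed.

Lemma cover_weight_gt0 n D : net_interval I n D -> 0 < cover_weight n D.
Proof.
move=> /net_covered[u uL uD].
have := @stopE_ge_word _ _ I _ (fun u => (covers u D)%:R) u (min_ratio_exp_gt0 I n) _ uL.
by rewrite uD mulr1 => /(_ ltac:(by [])); apply: lt_le_trans; exact: word_weight_gt0.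
Qed.

Lemma net0 : net_interval I 0 (0, 1).
Proof.
split => //=; [by apply: endpoint_z; left|by apply: endpoint_z; right|].
move=> h [u /= ->] /= [] -> []; by rewrite ltxx.
Qed.

(** The suffixes counted on the left are edge paths of D, with u and D' as witnesses; the edge paths
    on the other side only add weight. *)
Lemma edge_weight_ge N n D D' u z : net_interval I N D -> net_interval I (N + n) D' ->
  D.1 <= D'.1 -> D'.2 <= D.2 -> stopb I (lam ^+ N) u -> covers u D -> z = 0 \/ z = 1 ->
  E (lam ^+ (N + n) / rw u) (fun w => (covers (u ++ w) D' && (S w z == z))%:R)
    <= edge_weight I N D n.
Proof.
move=> nD nD' h1 h2 uN uD zP.
have D12 := ltW (net_lt nD); have D12' := ltW (net_lt nD').
pose B := [set w | is_path I N D n w /\ S w z = z].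
have Bge0 (A : set (seq 'I_m.+1)) : 0 <= \sum_(w \in A) pw w.
  by apply: fsumr_ge0 => w _; exact/ltW/word_weight_gt0.
apply: (@le_trans _ _ (\sum_(w \in B) pw w)); last first.
  rewrite /B /edge_weight /left_edge_weight /right_edge_weight.
  by case: zP => ->; [rewrite lerDl|rewrite lerDr].
rewrite (@eq_stopE _ _ _ _ _ (fun w => (`[<covers (u ++ w) D' /\ S w z = z>])%:R)) ?lam_div_gt0//; last first.
  move=> w _; congr ((nat_of_bool _)%:R).
  by apply/andP/asboolP => -[-> /eqP]; rewrite ?asboolE.
apply: le_stopE_fsum; first exact: lam_div_gt0.
  apply: (@stopb_path_finite _ _ I N n) => w [[v [D'' [_ _ [vL _] vw _]]] _].
  by exists v.
move=> w ws [cw wz]; split => //; exists u, D'; rewrite !LambdaE /=; split => //.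
- exact/interval_sub.
- by split => //; apply/coversP.
- by rewrite (stopb_lam_cat _ (leq_addr _ _)).
- exact/coversP.
Qed.

Lemma edge_weight_ge0 N D n : 0 <= edge_weight I N D n.
Proof. by apply: addr_ge0; apply: fsumr_ge0 => w _; exact/ltW/word_weight_gt0. Qed.

Lemma Q_sup_ge (mu : probability (measurableTypeR R) R) N n D D' :
  supp mu = `[0, 1]%classic ->
  net_interval I N D -> net_interval I (N + n) D' -> D.1 <= D'.1 -> D'.2 <= D.2 ->
  ((cover_weight N D / cover_weight (N + n) D')%:E <= Q_sup I mu n)%E.
Proof.
move=> supp01 nD nD' h1 h2; have [a _ _ b] := net01 nD'; have ab := net_lt nD'.
(* At an interior point of D' no other net interval of level N + n competes, so the minimality
   clause of [Q_at] is automatic. *)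
pose x := (D'.1 + D'.2) / 2.
have x1 : D'.1 < x by rewrite /x; lra.
have x2 : x < D'.2 by rewrite /x; lra.
apply: (@le_trans _ _ (Q_at I x n)); last first.
  apply: ereal_sup_ubound; exists x => //; rewrite supp01 /= in_itv/=; lra.
apply: ereal_sup_ubound; exists N, D, D'; split.
- by split => //; rewrite /interval_of /= in_itv/=; lra.
- by split => //; rewrite /interval_of /= in_itv/=; lra.
- by apply/interval_sub => //; exact: ltW.
- move=> D'' nD''; rewrite /interval_of /= in_itv/= => /andP[x3 x4] _.
  rewrite (net_eq nD' nD'')//; lra.
- by rewrite !net_weightE//; [exact: ltW|exact/ltW/(net_lt nD)].
Qed.

End NetIntervals.

(** * Comparison of cover weights across levels and between neighbouring net intervals *)

Section Adjacency.
Context {R : realType} {m : nat}.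
Variable I : weighted_ifs R m.
Implicit Types (t s x : R) (u v w : seq 'I_m.+1) (D : R * R).
Local Notation rw := (word_ratio I).
Local Notation lam := (min_ratio I).
Local Notation S := (word_map I).
Local Notation E := (stopE I).
Local Notation net := (net_interval I).
Local Notation cw := (cover_weight I).
Local Notation edge := (edge_weight I).

Hypothesis att : is_attractor I `[0, 1]%classic.
Hypothesis left_map : ifs_map I ord0 0 = 0.
Hypothesis right_map : ifs_map I ord_max 1 = 1.

(** The bound Q_n sup Gamma <= q^n for n >= n0, spelled out for individual net intervals and cleared
    of quotients and extended reals. D and D1 are unrelated, as the two suprema are taken
    independently. *)
Definition edge_bound (q : R) (n0 : nat) := forall n N N1 D D' D1, (n0 <= n)%N ->
  net N D -> net (N + n) D' -> D.1 <= D'.1 -> D'.2 <= D.2 -> net N1 D1 ->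
  cw N D * edge N1 D1 n <= q ^+ n * cw (N + n) D'.

Lemma generalized_regular_edge_bound (mu : probability (measurableTypeR R) R) (q : R) :
  supp mu = `[0, 1]%classic -> generalized_regular I mu -> 1 < q ->
  exists n0, (0 < n0)%N /\ edge_bound q n0.
Proof.
move=> supp01 gr q1; have q0 : 0 < q by exact: lt_trans q1.
have /(gr q q1)[n1 _ n1P] : nbhs (0%E : \bar R) [set y | (y < 1%:E)%E].
  apply: open_nbhs_nbhs; split; first exact: open_ereal_lt_ereal.
  by rewrite /= lte_fin ltr01.
exists n1.+1; split => // n N N1 D D' D1 n1n nD nD' h1 h2 nD1.
have {n1P}/ltW := n1P n (ltnW n1n); apply: contraTT; rewrite -!ltNge => h.
(* A violation of the bound makes one particular product exceed 1, and this product is at most the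
   quantity that is already below 1. *)
have w0 := cover_weight_gt0 att nD'.
have w1 := cover_weight_ge0 I N D.
apply: (@lt_le_trans _ _ ((cw N D / cw (N + n) D')%:E * (q ^- n)%:E * (edge N1 D1 n)%:E)%E).
  rewrite -!EFinM lte_fin.
  have -> : cw N D / cw (N + n) D' / q ^+ n * edge N1 D1 n =
            cw N D * edge N1 D1 n / (q ^+ n * cw (N + n) D') by rewrite invfM; ring.
  by rewrite ltr_pdivlMr ?mulr_gt0 ?exprn_gt0// mul1r.
apply: lee_pmul.
- rewrite -EFinM lee_fin; apply: mulr_ge0; first exact: divr_ge0 w1 (ltW w0).
  by rewrite invr_ge0 exprn_ge0// ltW.
- by rewrite lee_fin; exact: edge_weight_ge0.
- apply: lee_wpmul2r; first by rewrite lee_fin invr_ge0 exprn_ge0// ltW.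
  exact: Q_sup_ge.
- by apply: ereal_sup_ubound; exists N1, D1.
Qed.

Variables (q : R) (n0 : nat).
Hypothesis q1 : 1 <= q.
Hypothesis n0_gt0 : (0 < n0)%N.
Hypothesis edgeP : edge_bound q n0.

Lemma cover_weight_edge n i M N1 D D1 : (n0 <= n)%N -> (i + n <= M)%N ->
  net M D -> net N1 D1 -> cw i D * edge N1 D1 n <= q ^+ n * cw (i + n) D.
Proof.
move=> n0n iM nD nD1; have D12 := net_lt nD.
have [A [nA a1 a2]] := net_ancestor att left_map right_map iM nD.
have [B [nB b1 b2]] := net_ancestor att left_map right_map (leq_addr n i) nA.
rewrite (cover_weight_sub nA a1 a2 D12).
rewrite (cover_weight_sub nB (le_trans b1 a1) (le_trans a2 b2) D12).
exact: edgeP.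
Qed.

(** The quantity e_n: the weight of the cylinders of level n that start at 0. *)
Definition left_mass n := E (lam ^+ n) (fun w => (S w 0 == 0)%:R).

(** Every word fixing 0 covers the left-most net interval of level n, so all these words are
    left-edge paths of [0, 1] towards the same D. *)
Lemma left_mass_le_edge n : left_mass n <= edge 0 (0, 1) n.
Proof.
have n00 : net 0 (0, 1) by exact: net0.
have [|D [nD /andP[D1 D2]]] := @net_at_right _ _ I left_map right_map n 0.
  by rewrite lexx ltr01.
have [d1 _ _ d2] := net01 att nD.
have := @edge_weight_ge _ _ I 0 n (0, 1) D [::] 0 n00 nD d1 d2.
rewrite expr0 stopb_ge1// /covers /= !lexx word_ratio_nil divr1 add0n.
move=> /(_ isT isT (or_introl erefl)); apply: le_trans.
apply: ler_stopE; first exact: min_ratio_exp_gt0.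
move=> w wL; case: eqP => [w0|]; rewrite ?ler0n//.
have -> : S w 0 <= D.1 by rewrite w0.
have -> // : D.2 <= S w 1.
apply: (net_right nD); first by apply: endpoint_of => //; right.
by apply: le_lt_trans D1 _; rewrite -{1}w0 word_map_lt.
Qed.

Lemma left_mass_gt0 n : 0 < left_mass n.
Proof.
have [w [ws wz]] := stopb_edge_ex left_map right_map (min_ratio_exp_gt0 I n) (or_introl (erefl 0)).
have := @stopE_ge_word _ _ I _ (fun u => (S u 0 == 0)%:R) w (min_ratio_exp_gt0 I n) _ ws.
rewrite wz eqxx mulr1 => /(_ ltac:(by [])); apply: lt_le_trans; exact: word_weight_gt0.
Qed.

Lemma cover_weight_left_mass n i M D : (n0 <= n)%N -> (i + n <= M)%N -> net M D ->
  cw i D * left_mass n <= q ^+ n * cw (i + n) D.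
Proof.
move=> n0n iM nD.
apply: le_trans (cover_weight_edge n0n iM nD (net0 left_map right_map)).
by rewrite ler_wpM2l ?cover_weight_ge0// left_mass_le_edge.
Qed.

Definition step_const := q ^+ n0 / left_mass n0.

Lemma step_const_ge0 : 0 <= step_const.
Proof.
by rewrite divr_ge0 ?exprn_ge0// ?(ltW (left_mass_gt0 _))// (le_trans _ q1).
Qed.

(** Levels less than n0 apart are out of reach of [edge_bound], so the comparison goes from i to i +
    n0 and back to k by monotonicity. As i + n0 may exceed N, D is first replaced by a descendant D'
    of level N + n0, which has the same cover weights up to level N. *)
Lemma cover_weight_step i k N D : (k <= N)%N -> (k <= i + n0)%N -> (i <= k)%N -> net N D ->
  cw i D <= step_const * cw k D.
Proof.
move=> kN kn ik nD.
have [D' [nD' d1 d2]] := net_descendant att left_map right_map (leq_addr n0 N) nD.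
have D12' := net_lt nD'; have D12 := net_lt nD.
have cwE j : (j <= N)%N -> cw j D = cw j D'.
  move=> jN; have [A [nA a1 a2]] := net_ancestor att left_map right_map jN nD.
  rewrite (cover_weight_sub nA a1 a2 D12).
  by rewrite (cover_weight_sub nA (le_trans a1 d1) (le_trans d2 a2) D12').
rewrite !cwE ?(leq_trans ik)//.
apply: (@le_trans _ _ (step_const * cw (i + n0) D')); last first.
  by rewrite ler_wpM2l ?step_const_ge0// (cover_weight_mono att).
rewrite /step_const mulrAC ler_pdivlMr ?left_mass_gt0//.
by apply: (cover_weight_left_mass _ _ nD') => //; rewrite leq_add2r (leq_trans ik).
Qed.

Section OneSide.
(* h is the common end point of D1 and D2, z = 1 if D1 lies to the left of D2 and
   z = 0 if it lies to the right. *)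
Variables (N : nat) (D1 D2 : R * R) (z h : R).
Hypothesis nD1 : net N D1.
Hypothesis nD2 : net N D2.
Hypothesis z01 : z = 0 \/ z = 1.
Hypothesis zh : z != h.
Hypothesis covers_other : forall i u, (i <= N)%N -> stopb I (lam ^+ i) u ->
  covers I u D1 -> S u z != h -> covers I u D2.
Hypothesis covers_edge : forall u w, S u z = h -> covers I (u ++ w) D1 -> S w z = z.

(* The weight of the words of level N covering D1 whose ancestor of level i does
   not yet end at h. *)
Let X i := E (lam ^+ i) (fun u => (S u z != h)%:R *
  E (lam ^+ N / rw u) (fun w => (covers I (u ++ w) D1)%:R)).

Let suffix_ge0 u : 0 <= E (lam ^+ N / rw u) (fun w => (covers I (u ++ w) D1)%:R).
Proof. by apply: stopE_ge0 => //; exact: lam_div_gt0. Qed.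

(** The loss from X i to X i.+1 comes from words whose ancestor first ends at h at level i + 1.
    Their ancestor of level i covers D1 without ending at h, hence covers D2, and G bounds the
    weight of what follows the hit. *)
Let X_step i G : (i < N)%N -> 0 <= G ->
  (forall y, stopb I (lam ^+ i.+1) y -> covers I y D1 -> S y z = h ->
     E (lam ^+ N / rw y) (fun w => (covers I (y ++ w) D1)%:R) <= G) ->
  X i <= X i.+1 + G * cw i D2.
Proof.
move=> iN G0 GP.
have ->: X i.+1 = E (lam ^+ i) (fun u => E (lam ^+ i.+1 / rw u)
   (fun v => (S (u ++ v) z != h)%:R *
     E (lam ^+ N / rw (u ++ v)) (fun w => (covers I ((u ++ v) ++ w) D1)%:R))).
  by rewrite /X [LHS](stopE_markov I _ (min_ratio_exp_gt0 I _) (min_ratio_exp_le I (leqnSn i))).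
rewrite /cover_weight -stopEZ -stopED.
apply: ler_stopE => [|u uL]; first exact: min_ratio_exp_gt0.
have s0 := lam_div_gt0 I i.+1 u.
have X0 : 0 <= E (lam ^+ i.+1 / rw u)
   (fun v => (S (u ++ v) z != h)%:R *
     E (lam ^+ N / rw (u ++ v)) (fun w => (covers I ((u ++ v) ++ w) D1)%:R)).
  by apply: stopE_ge0 => // v _; rewrite mulr_ge0.
have [uh|uh] := eqVneq (S u z) h; first by rewrite mul0r addr_ge0// mulr_ge0.
rewrite mul1r; have [uD1|uD1] := boolP (covers I u D1); last first.
  apply: (@le_trans _ _ 0); last by rewrite addr_ge0// mulr_ge0.
  apply: le_trans (suffix_weight_le att _ _ (lam_div_gt0 I N u)) _.
  by rewrite (negbTE uD1).
rewrite (covers_other (ltnW iN) uL uD1 uh) mulr1.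
rewrite -[X in _ + X](stopE_cst I G s0) -stopED.
rewrite (@stopE_markov _ _ I (lam ^+ i.+1 / rw u)) ?lam_div_gt0//; last first.
  by rewrite ler_pM2r ?invr_gt0 ?word_ratio_gt0// min_ratio_exp_le.
apply: ler_stopE => // v vs.
have -> : E (lam ^+ N / rw u / rw v) (fun w => (covers I (u ++ v ++ w) D1)%:R) =
    E (lam ^+ N / rw (u ++ v)) (fun w => (covers I ((u ++ v) ++ w) D1)%:R).
  rewrite word_ratio_cat invfM mulrA.
  by apply: eq_stopE => [|w _]; rewrite ?catA// divr_gt0 ?lam_div_gt0 ?word_ratio_gt0.
have [uth|uth] := eqVneq (S (u ++ v) z) h; last by rewrite mul1r lerDl.
rewrite mul0r add0r.
have [utD|utD] := boolP (covers I (u ++ v) D1).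
  by apply: GP => //; rewrite (stopb_lam_cat _ (leqnSn i)).
apply: le_trans (suffix_weight_le att _ _ (lam_div_gt0 I N _)) _.
by rewrite (negbTE utD).
Qed.

(** The bound telescopes X from 0 to N: X 0 is the cover weight of D1 because z differs from h, X N
    is at most that of D2, and each of the N losses is at most [step_const] q^N times the latter. *)
Lemma cover_weight_neighbour :
  cw N D1 <= (1 + N%:R * (step_const * q ^+ N)) * cw N D2.
Proof.
have q0 : 0 <= q := le_trans ler01 q1.
have X_bound i : (i < N)%N -> X i <= X i.+1 + step_const * q ^+ N * cw N D2.
  move=> iN; have [A [nA a1 a2]] := net_ancestor att left_map right_map iN nD1.
  have D12 := net_lt nD1.
  (* If at least n0 levels remain after the hit, the continuation is an edge path of the ancestor A
     and [edge_bound] applies from i + 1 to N. Otherwise N <= i + n0, and G = 1 with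
     [cover_weight_step] suffices. *)
  have [kn0|kn0] := leqP n0 (N - i.+1).
    apply: le_trans (X_step iN (edge_weight_ge0 I i.+1 A (N - i.+1)) _) _.
      move=> y yL yD yh.
      rewrite (covers_sub nA yL a1 a2 D12) in yD.
      have := edge_weight_ge (n := N - i.+1) (z := z) nA.
      rewrite subnKC// => /(_ D1 y nD1 a1 a2 yL yD z01); apply: le_trans.
      apply: ler_stopE; first exact: lam_div_gt0.
      move=> w _; case c : (covers _ _ _) => //=; first by rewrite (covers_edge yh c) eqxx.
    rewrite lerD2l mulrC.
    apply: (@le_trans _ _ (step_const * cw i.+1 D2 * edge i.+1 A (N - i.+1))).
      rewrite ler_wpM2r ?edge_weight_ge0//.
      by apply: (cover_weight_step _ _ _ nD2) => //; rewrite -addn1 leq_add2l.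
    rewrite -(mulrA _ _ (edge _ _ _)) -(mulrA _ _ (cw N D2)).
    apply: ler_wpM2l; first exact: step_const_ge0.
    have := cover_weight_edge (i := i.+1) kn0 _ nD2 nA.
    rewrite subnKC// => /(_ (leqnn N)) h1; apply: le_trans h1 _.
    by rewrite ler_wpM2r ?cover_weight_ge0// ler_weXn2l// leq_subr.
  apply: le_trans (X_step iN ler01 _) _.
    move=> y _ _ _; apply: le_trans (suffix_weight_le att _ _ (lam_div_gt0 I N y)) _.
    by case: covers.
  rewrite lerD2l mul1r.
  apply: (@le_trans _ _ (step_const * cw N D2)).
    by apply: (cover_weight_step _ _ _ nD2) => //; lia.
  rewrite ler_wpM2r ?cover_weight_ge0// ler_peMr ?step_const_ge0//.
  exact: exprn_ege1.
have X0 : X 0 = cw N D1.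
  by rewrite /X expr0 stopE_ge1// zh mul1r word_ratio_nil divr1.
have XN : X N <= cw N D2.
  apply: ler_stopE; first exact: min_ratio_exp_gt0.
  move=> u uL; rewrite stopE_ge1; last first.
    by rewrite ler_pdivlMr ?word_ratio_gt0// mul1r stopb_ratio_le.
  rewrite cats0; case: eqVneq => [|uh]; rewrite ?mul0r ?mul1r//.
  by case c : (covers I u D1) => //; rewrite (covers_other (leqnn N) uL c uh).
have Xk k : (k <= N)%N -> X 0 <= X k + k%:R * (step_const * q ^+ N * cw N D2).
  elim: k => [|k ih] kN; first by rewrite mul0r addr0.
  apply: le_trans (ih (ltnW kN)) _.
  rewrite -natr1 mulrDl mul1r addrA (addrAC (X k.+1)) lerD2r.
  exact: X_bound.
rewrite -X0; apply: le_trans (Xk N (leqnn N)) _.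
by rewrite mulrDl mul1r mulrA lerD2r.
Qed.

End OneSide.

Definition neighbour_const N := 1 + N%:R * (step_const * q ^+ N).

(** Here z = 1. A right end beyond h is an end point of level N, so it lies at or beyond the right
    end of D2. After a hit, reaching h again forces S_w(1) = 1 since S_w(1) <= 1. *)
Lemma neighbour_right N D1 D2 : net N D1 -> net N D2 -> D1.2 = D2.1 ->
  cw N D1 <= neighbour_const N * cw N D2.
Proof.
move=> nD1 nD2 hE; have d1 := net_lt nD1; have d2 := net_lt nD2.
have [_ _ _ b2] := net01 att nD2.
apply: (@cover_weight_neighbour N D1 D2 1 D1.2) => //; first by right.
- by rewrite gt_eqF// hE (lt_le_trans d2).
- move=> i u iN uL /andP[u0 u1] uh; apply/andP; split.
    by rewrite -hE (le_trans u0)// ltW.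
  apply: (net_right nD2); last by rewrite -hE lt_neqAle eq_sym uh.
  by apply: (endpoint_mono left_map right_map iN); apply: endpoint_of => //; right.
- move=> u w uh /andP[_]; rewrite word_map_cat -uh => h.
  apply/(@word_map_inj _ _ I u)/le_anti; rewrite h andbT word_map_le//.
  by have /andP[] := @word_map01 _ _ I att w 1 ltac:(by rewrite lexx ler01).
Qed.

Lemma neighbour_left N D1 D2 : net N D1 -> net N D2 -> D1.2 = D2.1 ->
  cw N D2 <= neighbour_const N * cw N D1.
Proof.
move=> nD1 nD2 hE; have d1 := net_lt nD1; have d2 := net_lt nD2.
have [a1 _ _ _] := net01 att nD1.
apply: (@cover_weight_neighbour N D2 D1 0 D1.2) => //; first by left.
- by rewrite lt_eqF// (le_lt_trans a1).
- move=> i u iN uL /andP[u0 u1] uh; apply/andP; split; last first.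
    by rewrite hE (le_trans _ u1)// ltW.
  apply: (net_left nD1); last by rewrite lt_neqAle uh hE.
  by apply: (endpoint_mono left_map right_map iN); apply: endpoint_of => //; left.
- move=> u w uh /andP[]; rewrite word_map_cat -hE -uh => h _.
  apply/(@word_map_inj _ _ I u)/le_anti; rewrite h word_map_le//.
  by have /andP[] := @word_map01 _ _ I att w 0 ltac:(by rewrite lexx ler01).
Qed.

End Adjacency.

Lemma unit_window (R : realDomainType) (y : R) n : 0 <= y -> y < n%:R ->
  exists2 k, (k < n)%N & k%:R <= y < k.+1%:R.
Proof.
move=> y0; elim: n => [|n ih] yn; first by move: yn; rewrite ltNge y0.
have [/ih[k kn kP]|ny] := ltP y n%:R; first by exists k => //; exact: ltnW.
by exists n => //; rewrite ny.
Qed.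

(** * The complement of the support is null *)

Section NullOutside.
Context {R : realType}.
Variable mu : probability (measurableTypeR R) R.

Definition mass (A : set R) : R := fine (mu A).

Lemma mu_fin (A : set R) : measurable A -> mu A = (mass A)%:E.
Proof. by move=> mA; rewrite /mass fineK// fin_num_measure. Qed.

Lemma mass_ge0 (A : set R) : 0 <= mass A.
Proof. exact/fine_ge0/measure_ge0. Qed.

Lemma mass_le1 (A : set R) : measurable A -> mass A <= 1.
Proof. by move=> mA; rewrite -lee_fin -mu_fin// probability_le1. Qed.

Lemma le_mass (A B : set R) : measurable A -> measurable B -> A `<=` B -> mass A <= mass B.
Proof. by move=> mA mB AB; rewrite -lee_fin -!mu_fin// le_measure ?inE. Qed.

(** The complement is covered by the countably many null intervals with rational ends, enumerated
    through [unpickle]. *)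
Lemma negligible_supp_compl : mu.-negligible (~` supp mu).
Proof.
pose G (c : rat * rat) : set (measurableTypeR R) :=
  if mass `]ratr c.1, ratr c.2[%classic == 0 then `]ratr c.1, ratr c.2[%classic else set0.
pose F n : set (measurableTypeR R) := oapp G set0 (unpickle n).
apply: (@negligibleS _ _ _ _ (\bigcup_k F k)); last first.
  apply: negligible_bigcup => n; rewrite /F.
  case: (unpickle n) => [c|]; last exact: negligible_set0.
  rewrite /oapp /G; case: eqP => [c0|_]; last exact: negligible_set0.
  have mc : measurable `]ratr c.1 : R, ratr c.2[%classic by exact: measurable_itv.
  by apply/negligibleP => //; have := mu_fin mc; rewrite c0.
move=> x /= /existsNP[r /not_implyP[r0 /negP]]; rewrite -leNgt /ball_mass => xr.
have [a] := @rat_in_itvoo R (x - r) x ltac:(lra); rewrite in_itv/= => /andP[a1 a2].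
have [b] := @rat_in_itvoo R x (x + r) ltac:(lra); rewrite in_itv/= => /andP[b1 b2].
have ab0 : mass `]ratr a, ratr b[%classic = 0.
  apply/le_anti; rewrite mass_ge0 andbT (le_trans _ xr)// le_mass//.
    exact: measurable_ball.
  by move=> y; rewrite /= in_itv/= ball_itv/= in_itv/= => /andP[y1 y2]; lra.
exists (pickle (a, b)); first by [].
rewrite /F pickleK /oapp /G ab0 eqxx.
by apply/andP; split.
Qed.

Lemma mass_off_supp (A : set R) : measurable A -> (forall x, A x -> ~ supp mu x) -> mass A = 0.
Proof.
move=> mA h; rewrite /mass measure_negligible//.
exact: negligibleS negligible_supp_compl.
Qed.

End NullOutside.

(** * Masses of balls against cover weights *)

Section BallMass.
Context {R : realType} {m : nat}.
Variable I : weighted_ifs R m.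
Variable mu : probability (measurableTypeR R) R.
Implicit Types (t s x : R) (u v w : seq 'I_m.+1) (D : R * R).
Local Notation rw := (word_ratio I).
Local Notation lam := (min_ratio I).
Local Notation S := (word_map I).
Local Notation E := (stopE I).
Local Notation net := (net_interval I).
Local Notation cw := (cover_weight I).
Local Notation M := (mass mu).

Hypothesis selfsim : self_similar I mu.

Lemma measurable_ifs_map_preimage j (A : set R) : measurable A -> measurable (ifs_map I j @^-1` A).
Proof.
move=> mA; rewrite -[X in measurable X]setTI.
have : measurable_fun setT (ifs_map I j).
  by apply: measurable_funD => //; apply: measurable_funM.
by apply.
Qed.

Lemma mass_self_similar t (A : set R) : 0 < t -> measurable A ->
  M A = E t (fun u => M (S u @^-1` A)).
Proof.
move=> t0; elim/(stop_ind (I := I)): t / t0 A => t; first by move=> t1 A mA; rewrite stopE_ge1.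
move=> t0 t1 ih A mA; rewrite stopE_lt1//.
have -> : M A = \sum_(j < m.+1) weight I j * M (ifs_map I j @^-1` A).
  apply/EFin_inj; rewrite -mu_fin// (selfsim mA) -sumEFin.
  by apply: eq_bigr => j _; rewrite mu_fin//; exact: measurable_ifs_map_preimage.
by apply: eq_bigr => j _; congr (_ * _); apply: ih; exact: measurable_ifs_map_preimage.
Qed.

Lemma measurable_word_map_preimage u (A : set R) : measurable A -> measurable (S u @^-1` A).
Proof.
move=> mA; elim: u A mA => [|j u ih] A mA; first exact: mA.
by have := ih _ (measurable_ifs_map_preimage j mA).
Qed.

Hypothesis att : is_attractor I `[0, 1]%classic.
Hypothesis supp01 : supp mu = `[0, 1]%classic.

(** In the iterated self-similarity relation, a word whose cylinder misses A contributes 0, as mu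
    lives on [0, 1]; any other contributes at most its weight. *)
Lemma mass_le_meeting n (A : set R) (P : pred (seq 'I_m.+1)) : measurable A ->
  (forall u x, stopb I (lam ^+ n) u -> 0 <= x <= 1 -> A (S u x) -> P u) ->
  M A <= E (lam ^+ n) (fun u => (P u)%:R).
Proof.
move=> mA AP; have l0 := min_ratio_exp_gt0 I n.
rewrite (mass_self_similar l0 mA); apply: ler_stopE => // u uL.
have [Pu|nPu] := boolP (P u).
  by apply: mass_le1; exact: measurable_word_map_preimage.
rewrite mass_off_supp//; first exact: measurable_word_map_preimage.
move=> x /= Ax; rewrite supp01 /= in_itv/= => x01.
by move: nPu; rewrite (AP u x).
Qed.

(** If u covers D, then S_u maps (-1, 1) into the interval of radius 2 r_u about x. The open ball
    about 0 serves because its mass is positive as soon as 0 is in the support. *)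
Lemma ball_mass_ge n x r D : net n D -> D.1 <= x <= D.2 -> 2 * lam ^+ n < r ->
  M (ball 0 1) * cw n D <= ball_mass mu x r.
Proof.
move=> nD /andP[x1 x2] nr; have l0 := min_ratio_exp_gt0 I n.
change (M (ball 0 1) * cw n D <= M (ball x r)).
have mB : measurable (ball x r) by exact: measurable_ball.
rewrite (mass_self_similar l0 mB) -stopEZ; apply: ler_stopE => // u uL.
case c : (covers I u D); last by rewrite mulr0 mass_ge0.
rewrite mulr1; apply: le_mass; first exact: measurable_ball.
  exact: measurable_word_map_preimage.
move=> y /=; rewrite !ball_itv/= !in_itv/= => /andP[y1 y2].
have := stopb_ratio_le uL; move: c => /andP[]; rewrite word_map1 (word_map_affine I u y).
have r0 := word_ratio_gt0 I u.
move: (rw u) (S u 0) (lam ^+ n) r0 nr {uL l0} => a b l a0 lr ub ub2 al.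
have h1 : a * y < a by rewrite -[ltRHS]mulr1 ltr_pM2l//; lra.
have h2 : - a < a * y by rewrite -[ltLHS]mulr1 mulNr -mulrN ltr_pM2l//; lra.
lra.
Qed.

Hypothesis left_map : ifs_map I ord0 0 = 0.
Hypothesis right_map : ifs_map I ord_max 1 = 1.

Lemma net_length n D : net n D -> D.2 - D.1 <= lam ^+ n.
Proof.
move=> /(net_covered att)[u /stopb_ratio_le ul /andP[u0]]; rewrite word_map1 => u1; lra.
Qed.

Variable a : R.
Hypothesis a0 : 0 < a.
Hypothesis wscP : forall n u w (z : R), (0 < n)%N -> Lambda I n u -> Lambda I n w ->
      z = 0 \/ z = 1 -> S u z <> S w z -> a * lam ^+ n <= `|S u z - S w z|.

(** Weak separation is applied to u and a word of level n fixing 0: S_u(0) is either 0 or at least a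
    lam^n, so only cylinders starting at 0 meet the ball inside [0, 1]. *)
Lemma left_mass_ge n : (0 < n)%N -> ball_mass mu 0 (a * lam ^+ n) <= left_mass I n.
Proof.
move=> n0; change (M (ball 0 (a * lam ^+ n)) <= left_mass I n).
apply: mass_le_meeting; first exact: measurable_ball.
move=> u x uL x01; rewrite ball_itv/= in_itv/= => /andP[_ ux].
apply: contraT => /eqP u0.
have [v [vL v0]] := stopb_edge_ex left_map right_map (min_ratio_exp_gt0 I n) (or_introl (erefl 0)).
have := @wscP n u v 0 n0; rewrite !LambdaE v0 subr0 => /(_ uL vL (or_introl erefl) u0).
rewrite ger0_norm; last first.
  by have /andP[] := @word_map01 _ _ I att u 0 ltac:(by rewrite lexx ler01).
by have := word_map_le I u (proj1 (andP x01)); lra.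
Qed.

(* Among three end points, two are images of the same z in {0, 1}. *)
Lemma endpoint_gap n x y z : (0 < n)%N -> level_endpoints I n x ->
  level_endpoints I n y -> level_endpoints I n z -> x < y -> y < z -> a * lam ^+ n <= z - x.
Proof.
move=> n0 /endpointP[u [s [uL sP xE]]] /endpointP[v [t [vL tP yE]]].
move=> /endpointP[w [t' [wL tP' zE]]] xy yz.
have gap b u' v' : stopb I (lam ^+ n) u' -> stopb I (lam ^+ n) v' -> b = 0 \/ b = 1 ->
    S u' b < S v' b -> a * lam ^+ n <= S v' b - S u' b.
  move=> uL' vL' bP uv; rewrite -(gtr0_norm (x := _ - _)) ?subr_gt0//.
  by apply: wscP; rewrite ?LambdaE//; apply/eqP; rewrite gt_eqF.
case: sP tP tP' xE yE zE => -> [] -> [] -> xE yE zE; rewrite xE yE zE in xy yz *;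
  solve [ apply: gap => //; [by left|exact: lt_trans yz]
        | apply: gap => //; [by right|exact: lt_trans yz]
        | apply: (@le_trans _ _ (S v 0 - S u 0)); [apply: gap => //; by left|lra]
        | apply: (@le_trans _ _ (S v 1 - S u 1)); [apply: gap => //; by right|lra]
        | apply: (@le_trans _ _ (S w 0 - S v 0)); [apply: gap => //; by left|lra]
        | apply: (@le_trans _ _ (S w 1 - S v 1)); [apply: gap => //; by right|lra] ].
Qed.

Lemma net_pred n D : net n D -> 0 < D.1 -> exists2 D', net n D' & D'.2 = D.1.
Proof.
move=> nD D0; have [_ d1 _ _] := net01 att nD.
have [|D' [nD' /andP[h1 h2]]] := @net_at_left _ _ I left_map right_map n D.1.
  by rewrite D0.
exists D' => //; apply: le_anti; rewrite h2 andbT.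
by apply: (net_right nD') => //; case: nD.
Qed.

Variables (q : R) (n0 : nat).
Hypothesis q1 : 1 <= q.
Hypothesis n0_gt0 : (0 < n0)%N.
Hypothesis edgeP : edge_bound I q n0.
Local Notation K := (neighbour_const I q n0).

Lemma neighbour_const_ge1 N : 1 <= K N.
Proof.
rewrite lerDl mulr_ge0// mulr_ge0 ?exprn_ge0 ?(le_trans _ q1)//.
exact: step_const_ge0.
Qed.

(** By [endpoint_gap], two moves to the left neighbour shift the left end by at least a lam^N. So 2j
    moves, each costing a factor K N, lead from D' to D. *)
Lemma net_chain N D D' j : (0 < N)%N -> net N D -> net N D' -> D.1 <= D'.1 ->
  D'.1 - D.1 <= j%:R * (a * lam ^+ N) ->
  cw N D' <= K N ^+ j.*2 * cw N D /\ cw N D <= K N ^+ j.*2 * cw N D'.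
Proof.
move=> N0; have K1 := neighbour_const_ge1 N; have K0 := le_trans ler01 K1.
have Kpow i (c : R) : 0 <= c -> c <= K N ^+ i * c.
  by move=> c0; rewrite ler_peMl// exprn_ege1.
elim: j D' => [|j ih] D' nD nD' DD'.
  rewrite mul0r subr_le0 => D'D; have DE : D = D'.
    by apply: (net_eq nD nD'); rewrite ?(le_lt_trans DD' (net_lt nD'))// (le_lt_trans D'D (net_lt nD)).
  by rewrite DE expr0 mul1r.
have [-> _|DD] := eqVneq D D'; first by rewrite !Kpow ?cover_weight_ge0.
have {}DD' : D.1 < D'.1.
  rewrite lt_neqAle DD' andbT; apply: contra DD => /eqP h; apply/eqP.
  by apply: (net_eq nD nD'); rewrite ?h ?(net_lt nD')// -h (net_lt nD).
move=> hj; have [d0 _ _ _] := net01 att nD.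
have [D1 nD1 D1E] := net_pred nD' (le_lt_trans d0 DD').
have DD1 : D.1 <= D1.1 by apply: (net_left nD1); [case: nD|rewrite D1E].
have h1 := neighbour_right att left_map right_map q1 n0_gt0 edgeP nD1 nD' D1E.
have h2 := neighbour_left att left_map right_map q1 n0_gt0 edgeP nD1 nD' D1E.
have doubleE : K N ^+ j.+1.*2 = K N ^+ j.*2 * K N * K N by rewrite doubleS !exprSr.
(* The walk may end after an odd number of moves; the spare factors are at least 1. *)
have [DE|DD1'] := eqVneq D D1.
  rewrite -DE in h1 h2; have := Kpow j.*2.+1 1 ler01; rewrite mulr1 => Kj.
  have KK : K N <= K N ^+ j.+1.*2.
    by rewrite doubleS -[leLHS]expr1 ler_weXn2l.
  by split; [apply: (le_trans h2)|apply: (le_trans h1)]; rewrite ler_wpM2r ?cover_weight_ge0.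
have {}DD1' : D.1 < D1.1.
  rewrite lt_neqAle DD1 andbT; apply: contra DD1' => /eqP h; apply/eqP.
  by apply: (net_eq nD nD1); rewrite ?h ?(net_lt nD1)// -h (net_lt nD).
have [D2 nD2 D2E] := net_pred nD1 (le_lt_trans d0 DD1').
have DD2 : D.1 <= D2.1 by apply: (net_left nD2); [case: nD|rewrite D2E].
have h3 := neighbour_right att left_map right_map q1 n0_gt0 edgeP nD2 nD1 D2E.
have h4 := neighbour_left att left_map right_map q1 n0_gt0 edgeP nD2 nD1 D2E.
have gap : a * lam ^+ N <= D'.1 - D2.1.
  apply: (endpoint_gap (y := D1.1) N0); try by case: (nD2); case: (nD1); case: (nD').
    by rewrite -D2E (net_lt nD2).
  by rewrite -D1E (net_lt nD1).
have [|i1 i2] := ih D2 nD nD2 DD2.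
  by move: hj; rewrite -natr1 mulrDl mul1r; lra.
rewrite doubleE; split.
  apply: (le_trans h2); rewrite -!mulrA [leRHS]mulrCA ler_wpM2l//.
  by apply: (le_trans h4); rewrite [leRHS]mulrCA ler_wpM2l.
apply: (le_trans i2); rewrite -!mulrA ler_wpM2l ?exprn_ge0//.
by apply: (le_trans h3); rewrite ler_wpM2l.
Qed.

(** With l = lam^N, cylinders of level N meeting the ball start in an interval of length 3l, which L
    windows of length a l / 2 cover. By weak separation all cylinders starting in one window share
    their left end, so they cover one net interval D', whose left end is within 2l of that of D. *)
Lemma ball_mass_le (j L : nat) N x r D : 2 <= j%:R * a -> 3 < L%:R * (a / 2) ->
  (0 < N)%N -> net N D -> D.1 <= x <= D.2 -> r <= lam ^+ N ->
  ball_mass mu x r <= L%:R * (K N ^+ j.*2 * cw N D).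
Proof.
move=> ja La N0 nD /andP[Dx xD] rN.
have l0 := min_ratio_exp_gt0 I N; set l := lam ^+ N in l0 rN.
pose meets u := (S u 0 < x + l) && (x - l < S u 1).
have := @mass_le_meeting N (ball x r) meets (measurable_ball x r).
move=> /(_ _)/le_trans; apply.
  move=> u y uL /andP[y0 y1]; rewrite ball_itv/= in_itv/= => /andP[xy yx].
  by have := word_map_le I u y0; have := word_map_le I u y1; rewrite /meets; lra.
pose b := a / 2 * l; have b0 : 0 < b by rewrite mulr_gt0// divr_gt0.
pose window k u := meets u && (x - 2 * l + k%:R * b <= S u 0 < x - 2 * l + k.+1%:R * b).
apply: (@le_trans _ _ (\sum_(k <- iota 0 L) E l (fun u => (window k u)%:R))).
  rewrite -stopE_sum; apply: ler_stopE => // u uL.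
  case mu_u : (meets u); last by apply: sumr_ge0.
  have /andP[u0 u1] := mu_u; have ul : rw u <= l := stopb_ratio_le uL.
  rewrite word_map1 in u1.
  have [| |k kL /andP[k1 k2]] := @unit_window R ((S u 0 - (x - 2 * l)) / b) L.
  - by rewrite divr_ge0 ?(ltW b0)//; lra.
  - rewrite ltr_pdivrMr//; apply: (@lt_trans _ _ (3 * l)); first lra.
    by rewrite /b mulrA ltr_pM2r.
  rewrite (bigD1_seq k) ?iota_uniq ?mem_iota//= ler_wpDr ?sumr_ge0//.
  move: k1 k2; rewrite ler_pdivlMr// ltr_pdivrMr// => k1 k2.
  by rewrite /window mu_u /= (_ : _ && _); last by apply/andP; split; lra.
have KD0 : 0 <= K N ^+ j.*2 * cw N D.
  by rewrite mulr_ge0 ?cover_weight_ge0// exprn_ge0// (le_trans ler01)// neighbour_const_ge1.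
rewrite (_ : L%:R * _ = \sum_(k <- iota 0 L) (K N ^+ j.*2 * cw N D)); last first.
  by rewrite big_const_seq count_predT size_iota iter_addr_0 mulr_natl.
apply: ler_sum => k _.
(* An empty window contributes 0; otherwise [u0] supplies the common left end. *)
have [[u0 [u0L u0w]]|nou] := pselect (exists u, stopb I l u /\ window k u); last first.
  apply: le_trans KD0; rewrite -[leRHS](@stopE_cst _ _ I l 0)//.
  by apply: ler_stopE => // u uL; case wu : (window k u) => //; exfalso; apply: nou; exists u.
have /andP[u01 _] := @word_map01 _ _ I att u0 0 ltac:(by rewrite lexx ler01).
have /andP[_ u02] := @word_map01 _ _ I att u0 1 ltac:(by rewrite lexx ler01).
have [|D' [nD' /andP[D'1 D'2]]] := @net_at_right _ _ I left_map right_map N (S u0 0).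
  by rewrite u01 (lt_le_trans (word_map_lt I u0)).
have e0 u : stopb I l u -> level_endpoints I N (S u 0).
  by move=> uL; apply: endpoint_of => //; left.
have D'E : D'.1 = S u0 0.
  by apply/le_anti; rewrite D'1; apply: (net_left nD') => //; exact: e0.
apply: (@le_trans _ _ (cw N D')).
  apply: ler_stopE => // u uL; case wu : (window k u) => //.
  have uE : S u 0 = S u0 0.
    apply: contrapT => une; have := @wscP N u u0 0 N0.
    rewrite !LambdaE => /(_ uL u0L (or_introl erefl) une).
    move: wu u0w; rewrite /window => /andP[_ /andP[w1 w2]] /andP[_ /andP[w3 w4]].
    have : `|S u 0 - S u0 0| < b.
      by move: w2 w4; rewrite -natr1 mulrDl mul1r ltr_norml; lra.
    have : 0 < a * l by rewrite mulr_gt0.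
    by rewrite -/l /b; lra.
  rewrite (_ : covers I u D')//; apply/andP; rewrite uE D'E lexx; split => //.
  apply: (net_right nD'); first by apply: endpoint_of => //; right.
  by rewrite D'E -uE word_map_lt.
have Dl := net_length nD; rewrite -/l in Dl.
have jl : 2 * l <= j%:R * (a * l) by rewrite mulrA ler_pM2r.
move: u0w; rewrite /window /meets => /andP[/andP[v1 v2] _].
have u0l : rw u0 <= l := stopb_ratio_le u0L; rewrite word_map1 in v2.
have [DD'|D'D] := leP D.1 D'.1.
  by have [] := @net_chain N D D' j N0 nD nD' DD' _; first (rewrite -/l; lra).
by have [] := @net_chain N D' D j N0 nD' nD (ltW D'D) _; first (rewrite -/l; lra).
Qed.

End BallMass.

Lemma natr_exp_bound (R : realFieldType) (q : R) N : 1 < q -> N%:R <= q ^+ N / (q - 1).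
Proof.
move=> q1; rewrite ler_pdivlMr ?subr_gt0//; elim: N => [|N ih].
  by rewrite mul0r expr0.
have : 1 <= q ^+ N by rewrite exprn_ege1// ltW.
have : (q - 1) * 1 <= (q - 1) * q ^+ N by rewrite ler_pM2l ?subr_gt0// exprn_ege1// ltW.
by rewrite -natr1 exprS; move: (q ^+ N) ih => y; lra.
Qed.

Lemma exp_level (R : realType) (l x : R) : 0 < l -> l < 1 -> 0 < x -> x <= 1 ->
  exists N, l ^+ N.+1 < x /\ x <= l ^+ N.
Proof.
move=> l0 l1 x0 x1.
have ex : exists N, l ^+ N.+1 < x.
  have [k kP] := @exp_le_eps R l (x / 2) (ltW l0) l1 ltac:(by rewrite divr_gt0).
  exists k; rewrite exprS.
  have : l * l ^+ k <= 1 * l ^+ k by rewrite ler_wpM2r ?exprn_ge0// ltW.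
  by lra.
case: (ex_minnP ex) => -[|N] NP Nmin.
  by exists 0%N; rewrite expr0.
exists N.+1; split => //; rewrite leNgt; apply/negP => /Nmin.
by rewrite ltnn.
Qed.

(** * Upper local dimensions and the Assouad exponents *)

Section Dimension.
Context {R : realType}.
Variable mu : probability (measurableTypeR R) R.

Lemma ball_mass_gt0 x r : supp mu x -> 0 < r -> 0 < ball_mass mu x r.
Proof. by move=> xs; exact: xs. Qed.

Lemma ball_mass_le1 x r : ball_mass mu x r <= 1.
Proof. by apply: mass_le1; exact: measurable_ball. Qed.

(** The larger radius is frozen at [R0] while r tends to 0, so the constraint r <= R0^(1+delta)
    holds eventually and mu(B(x, r)) is at least a constant times r^s. *)
Lemma upper_local_dim_le (x : R) (delta : R) : 0 < delta -> supp mu x ->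
  (upper_local_dim mu x <= assouad_exponent mu delta)%E.
Proof.
move=> d0 xs; apply: le_ereal_inf_tmp => _ [s [C1 [C2 [C10 C20 CP]]] <-].
apply/lee_addgt0Pr => e e0; rewrite -EFinD.
pose R0 := Num.min C1 (1 / 2).
have R00 : 0 < R0 by rewrite /R0 lt_min C10 divr_gt0.
have R0C1 : R0 <= C1 by rewrite /R0 ge_min lexx.
have R01 : R0 <= 1 by rewrite /R0 ge_min; apply/orP; right; lra.
have R0d : R0 `^ (1 + delta) <= R0.
  by apply: ge1r_powR; [rewrite R00 R01|rewrite lerDl ltW].
set M0 := ball_mass mu x R0; have M00 : 0 < M0 by exact: ball_mass_gt0.
(* The exponent condition reads ln mu(B(x, r)) >= k + s ln r, and k is absorbed into e ln r once r <
   exp(k / e). *)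
pose k := ln M0 - ln C2 - s * ln R0.
pose V := [set r : R | 0 < r /\ r < Num.min (R0 `^ (1 + delta)) (Num.min 1 (expR (k / e)))].
have nV : (0^'+) V.
  have V0 : 0 < Num.min (R0 `^ (1 + delta)) (Num.min 1 (expR (k / e))).
    by rewrite !lt_min powR_gt0//= ltr01 expR_gt0.
  apply: filterI; first exact: nbhs_right_gt.
  exact: nbhs_right_lt.
apply: (@le_trans _ _ (ereal_sup ((fun r : R => (ln (ball_mass mu x r) / ln r)%:E) @` V))).
  by apply: ereal_inf_lbound; exists V.
apply: ge_ereal_sup => _ [r [r0 rV] <-]; rewrite lee_fin.
move: rV; rewrite !lt_min => /and3P[rR r1 rk].
have lr0 : ln r < 0 by rewrite ln_lt0// r0.
have Mr0 := ball_mass_gt0 xs r0.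
have : M0 / ball_mass mu x r <= C2 * (R0 / r) `^ s.
  rewrite -lee_fin; apply: le_trans (CP r R0 r0 (ltW rR) R0d R0C1).
  by apply: ereal_sup_ubound; exists x.
have Rr0 : 0 < R0 / r by rewrite divr_gt0.
rewrite -ler_ln ?posrE ?divr_gt0 ?mulr_gt0 ?powR_gt0//.
rewrite ln_div ?posrE// lnM ?posrE ?powR_gt0// ln_powR ln_div ?posrE// => h.
rewrite ler_ndivrMr//.
have : ln r < k / e by rewrite -[ltRHS]expRK ltr_ln ?posrE ?expR_gt0.
by rewrite ltr_pdivlMr// /k; lra.
Qed.

(** The gap between s' and s is what later pays for the powers of q. That s' >= 0 follows from
    masses being at most 1 while ln r < 0. *)
Lemma ball_mass_lower_bound (s : R) : supp mu 0 -> (upper_local_dim mu 0 < s%:E)%E ->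
  exists s', [/\ 0 <= s', s' < s & exists2 e, 0 < e & forall r, 0 < r -> r < e ->
    expR (s' * ln r) <= ball_mass mu 0 r].
Proof.
move=> s0 /ereal_inf_lt[_ [V nV <-] Vs].
have [s' s'V s's] : exists2 s' : R, (ereal_sup ((fun r : R =>
    (ln (ball_mass mu 0 r) / ln r)%:E) @` V) <= s'%:E)%E & s' < s.
  case: (ereal_sup _) Vs => [t| |]//= ts.
    by exists t => //; rewrite -lte_fin.
  by exists (s - 1); [rewrite leNye|lra].
have [e e0 eV] : exists2 e : R, 0 < e & forall r, 0 < r -> r < e -> V r.
  have [e /= e0 eP] := nV; exists e => // r r0 re; apply: eP => //=.
  by rewrite sub0r normrN gtr0_norm.
have key r : 0 < r -> r < Num.min e 1 -> s' * ln r <= ln (ball_mass mu 0 r).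
  rewrite lt_min => r0 /andP[re r1].
  have lr0 : ln r < 0 by rewrite ln_lt0// r0.
  rewrite -ler_ndivrMr// -lee_fin; apply: le_trans s'V.
  by apply: ereal_sup_ubound; exists r => //; exact: eV.
have e10 : 0 < Num.min e 1 by rewrite lt_min e0 ltr01.
exists s'; split => //.
  have r0 : 0 < Num.min e 1 / 2 by rewrite divr_gt0.
  have r1 : Num.min e 1 / 2 < Num.min e 1 by lra.
  have lr0 : ln (Num.min e 1 / 2) < 0.
    by rewrite ln_lt0// r0 (lt_le_trans r1)// ge_min lexx orbT.
  have := le_trans (key _ r0 r1) (ln_le0 (ball_mass_le1 _ _)).
  by rewrite nmulr_lle0.
exists (Num.min e 1) => // r r0 re.
by rewrite -[leRHS]lnK ?posrE ?ball_mass_gt0// ler_expR; exact: key.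
Qed.

End Dimension.

(** * Upper estimate of the Assouad exponents by the local dimension at 0 *)

Section Assouad.
Context {R : realType} {m : nat}.
Variable I : weighted_ifs R m.
Variable mu : probability (measurableTypeR R) R.
Local Notation lam := (min_ratio I).
Local Notation net := (net_interval I).
Local Notation cw := (cover_weight I).

Hypothesis att : is_attractor I `[0, 1]%classic.
Hypothesis left_map : ifs_map I ord0 0 = 0.
Hypothesis right_map : ifs_map I ord_max 1 = 1.
Hypothesis selfsim : self_similar I mu.
Hypothesis supp01 : supp mu = `[0, 1]%classic.
Hypothesis wsc : weak_separation I.
Hypothesis gr : generalized_regular I mu.

Lemma net_at n x : 0 <= x <= 1 -> exists2 D, net n D & D.1 <= x <= D.2.
Proof.
move=> /andP[x0 x1]; have [xlt1|x1'] := ltP x 1.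
  have [|D [nD /andP[h1 h2]]] := @net_at_right _ _ I left_map right_map n x.
    by rewrite x0.
  by exists D => //; rewrite h1 ltW.
have [|D [nD /andP[h1 h2]]] := @net_at_left _ _ I left_map right_map n x.
  by rewrite x1 (lt_le_trans ltr01).
by exists D => //; rewrite h2 ltW.
Qed.

(** The linear factor N is absorbed into a second power q^N. *)
Lemma neighbour_const_bound q n0 : 1 < q -> exists2 C, 0 < C &
  forall N, neighbour_const I q n0 N <= C * q ^+ N.*2.
Proof.
move=> q1; have c0 : 0 <= step_const I q n0 by exact: step_const_ge0 (ltW q1).
exists (1 + step_const I q n0 / (q - 1)).
  by rewrite ltr_pwDl// divr_ge0// subr_ge0 ltW.
move=> N; rewrite /neighbour_const mulrDl mul1r lerD//.
  by rewrite exprn_ege1// ltW.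
have qN : 0 < q ^+ N by rewrite exprn_gt0// (lt_trans _ q1).
have -> : step_const I q n0 / (q - 1) * q ^+ N.*2 =
    step_const I q n0 * (q ^+ N / (q - 1) * q ^+ N) by rewrite -addnn exprD; ring.
by rewrite mulrCA ler_wpM2l// ler_pM2r// natr_exp_bound.
Qed.

(** Four bounds are chained: mu(B(x, rho)) by the cover weight at level N, that weight by q^n / e_n
    times the one at level N + n, the latter by mu(B(x, r)), and e_n from below by (a lam^n)^s'. The
    powers of q fit into lam^(-n(s - s')) because N <= [kap] n. *)
Lemma assouad_exponent_le (delta s : R) : 0 < delta ->
  (upper_local_dim mu 0 < s%:E)%E -> (assouad_exponent mu delta <= s%:E)%E.
Proof.
move=> d0 Ds; have supp0 : supp mu 0 by rewrite supp01 /= in_itv/= lexx ler01.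
have [s' [s'0 s's [eps eps0 epsP]]] := ball_mass_lower_bound supp0 Ds.
have [a a0 wscP] := wsc.
have l0 := min_ratio_gt0 I; have l1 := min_ratio_lt1 I.
pose j := Num.bound (2 / a); pose L := Num.bound (3 / (a / 2)).
have ja : 2 <= j%:R * a.
  by rewrite -ler_pdivrMr// ltW// archi_boundP// divr_ge0// ltW.
have La : 3 < L%:R * (a / 2).
  by rewrite -ltr_pdivrMr ?divr_gt0// archi_boundP// divr_ge0// divr_ge0// ltW.
have [tau La0 lamE] : exists2 t : R, 0 < t & forall n, lam ^+ n = expR (- (n%:R * t)).
  exists (- ln lam); first by rewrite oppr_gt0 ln_lt0// l0.
  by move=> n; rewrite mulrN opprK expRM_natl lnK.
pose kap := Num.bound (1 / delta).
have kapd : 1 < kap%:R * delta.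
  by rewrite -ltr_pdivrMr// archi_boundP// divr_ge0// ltW.
(* With this q, q^(4jN + n) <= exp(nb) as soon as N <= kap n. *)
pose p := (4 * j * kap + 1)%N.
pose b := (s - s') * tau; have b0 : 0 < b by rewrite mulr_gt0// subr_gt0.
have p0 : 0 < (p%:R : R) by rewrite ltr0n /p addn1.
pose q := expR (b / p%:R); have q1 : 1 < q by rewrite expR_gt1 divr_gt0.
have [n0 [n0_gt0 eP]] := generalized_regular_edge_bound att supp01 gr q1.
have [C C0 CP] := neighbour_const_bound n0 q1.
have [n1 n1P] := @exp_le_eps R lam (eps / (2 * a)) (ltW l0) l1 ltac:(by rewrite divr_gt0// mulr_gt0).
(* Going d extra levels down absorbs the factor 2 in [ball_mass_ge]. *)
have [d dP] := @exp_le_eps R lam (lam / 2) (ltW l0) l1 ltac:(by rewrite divr_gt0).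
pose c0 := mass mu (ball 0 1); have c00 : 0 < c0 by exact: (ball_mass_gt0 supp0).
(* From N >= N0 and N <= [kap] n it follows that n >= n0 and n >= n1. *)
pose N0 := (kap * (maxn n0 n1)).+1.
(* The [+ 1] makes C2 positive without a case on L. The levels give rho / r >= lam^(-(M - N - 1)),
   and M - N - 1 = n - (d + 2). *)
pose C2 := (L%:R + 1) * C ^+ j.*2 / c0 * expR (s * (d.+2%:R * tau) - s' * ln a).
apply: ereal_inf_lbound; exists s => //; exists (lam ^+ N0), C2; split.
- exact: exprn_gt0.
- by rewrite mulr_gt0 ?expR_gt0// divr_gt0// mulr_gt0 ?exprn_gt0// ltr_wpDl.
move=> r rho r0 rrho rho_le rhoC.
have rho0 : 0 < rho.
  rewrite lt_neqAle eq_sym; apply/andP; split.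
    apply: contraTneq r0 => rho0; rewrite -leNgt (le_trans rrho)// rho0 powR0//.
    by rewrite gt_eqF// ltr_pwDl// ltW.
  exact: le_trans (ltW r0) (le_trans rrho rho_le).
have rho1 : rho <= 1 by apply: le_trans rhoC _; apply: exprn_ile1 => //; exact: ltW.
have r1 : r <= 1 by rewrite (le_trans rrho)// (le_trans rho_le).
have [N [NP NP']] := exp_level l0 l1 rho0 rho1.
have [M [MP MP']] := exp_level l0 l1 r0 r1.
(* The constraint r <= rho^(1+delta) in terms of levels; it yields N delta <= n below. *)
have NM : N%:R * (1 + delta) < M.+1%:R.
  have : lam ^+ M.+1 < (lam ^+ N) `^ (1 + delta).
    apply: (lt_le_trans MP); apply: (le_trans rrho).
    apply: ge0_ler_powR => //; rewrite ?nnegrE ?exprn_ge0// ltW//.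
    by rewrite ltr_pwDl// ltW.
  rewrite -ltr_ln ?posrE ?powR_gt0 ?exprn_gt0// ln_powR !lamE !expRK.
  by rewrite mulrN ltrN2 mulrA ltr_pM2r// mulrC.
have NN0 : (N0 <= N)%N.
  have : lam ^+ N.+1 < lam ^+ N0 by exact: lt_le_trans rhoC.
  by rewrite ltr_iXn2l// ltnS.
have NleM : (N <= M)%N.
  rewrite -ltnS -(ltr_nat R); apply: le_lt_trans NM.
  by rewrite ler_peMr// lerDl ltW.
pose n := (M + d.+1 - N)%N.
have nE : (N + n)%N = (M + d.+1)%N by rewrite subnKC// (leq_trans NleM)// leq_addr.
have Nkn : (N <= kap * n)%N.
  have h1 : N%:R * delta <= n%:R.
    have : (N + n)%:R = (M + d.+1)%:R :> R by rewrite nE.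
    rewrite !natrD -!natr1 => h; move: NM; rewrite -natr1 => NM.
    by have : 0 <= d%:R :> R := ler0n _ _; lra.
  have h2 : N%:R <= N%:R * (kap%:R * delta) by rewrite ler_peMr// ltW.
  rewrite -(ler_nat R) natrM; apply: le_trans h2 _.
  by rewrite mulrCA ler_wpM2l.
have kap0 : (0 < kap)%N by case: (kap) kapd => //; rewrite mul0r ltr10.
have nn : (maxn n0 n1 <= n)%N.
  by rewrite -(leq_pmul2l kap0); apply: leq_trans Nkn; apply: ltnW.
have n0n : (n0 <= n)%N by apply: leq_trans nn; exact: leq_maxl.
have n1n : (n1 <= n)%N by apply: leq_trans nn; exact: leq_maxr.
apply: ge_ereal_sup => _ [x xs <-]; rewrite lee_fin.
have Mr0 := ball_mass_gt0 xs r0.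
have x01 : 0 <= x <= 1 by move: xs; rewrite supp01 /= in_itv.
rewrite ler_pdivrMr//.
have [D nD xD] := net_at (N + n) x01.
have [D' [nD' d1 d2]] := net_ancestor att left_map right_map (leq_addr n N) nD.
have xD' : D'.1 <= x <= D'.2.
  by case/andP: xD => x1 x2; rewrite (le_trans d1)// (le_trans x2).
have upper := ball_mass_le selfsim att supp01 left_map right_map a0 wscP (ltW q1) n0_gt0 eP
  ja La (leq_trans (ltn0Sn _) NN0) nD' xD' NP'.
rewrite -(cover_weight_sub nD' d1 d2 (net_lt nD)) in upper.
have lower : c0 * cw (N + n) D <= ball_mass mu x r.
  apply: (ball_mass_ge selfsim nD xD); rewrite nE; apply: le_lt_trans MP.
  rewrite addnS exprS exprD exprS; have lM : 0 < lam ^+ M by exact: exprn_gt0.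
  have : lam ^+ M * (2 * lam ^+ d) <= lam ^+ M * lam by rewrite ler_pM2l//; lra.
  have h : lam ^+ M * (lam * lam ^+ d) <= lam ^+ M * (1 * lam ^+ d).
    by rewrite ler_pM2l// ler_wpM2r ?exprn_ge0// ltW.
  by lra.
have ratio_bound := cover_weight_left_mass att left_map right_map eP n0n (leqnn _) nD.
have alpos : 0 < a * lam ^+ n by rewrite mulr_gt0// exprn_gt0.
have left_bound : expR (s' * (ln a - n%:R * tau)) <= left_mass I n.
  have n_gt0 := leq_trans n0_gt0 n0n.
  apply: le_trans (left_mass_ge selfsim att supp01 left_map right_map wscP n_gt0).
  have -> : ln a - n%:R * tau = ln (a * lam ^+ n).
    by rewrite lnM ?posrE ?exprn_gt0// lamE expRK.
  apply: epsP => //; apply: (@le_lt_trans _ _ (a * (eps / (2 * a)))).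
    by rewrite ler_pM2l// (le_trans _ n1P)// min_ratio_exp_le.
  have -> : a * (eps / (2 * a)) = eps / 2 by field; rewrite gt_eqF.
  by lra.
set e := expR _ in left_bound; have e0 : 0 < e by exact: expR_gt0.
set K := neighbour_const I q n0 N in upper.
have K0 : 0 <= K.
  by apply: le_trans ler01 _; apply: neighbour_const_ge1 => //; exact: ltW.
have Kle : K ^+ j.*2 <= C ^+ j.*2 * q ^+ (N.*2 * j.*2).
  by rewrite exprM -exprMn lerXn2r// ?nnegrE ?CP// (le_trans K0 (CP N)).
have Cj0 : 0 <= C ^+ j.*2 by rewrite exprn_ge0// ltW.
have qpow : q ^+ (N.*2 * j.*2) * q ^+ n <= expR (n%:R * b).
  rewrite -exprD -expRM_natl ler_expR mulrA ler_pdivrMr// mulrAC ler_pM2r//.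
  rewrite -natrM ler_nat /p mulnDr muln1 leq_add2r -!muln2.
  have -> : (N * 2 * (j * 2) = 4 * j * N)%N by ring.
  have -> : (n * (4 * j * kap) = 4 * j * (kap * n))%N by ring.
  by rewrite leq_mul2l Nkn orbT.
have cwN : cw N D <= q ^+ n * (ball_mass mu x r / c0) / e.
  rewrite ler_pdivlMr//; apply: le_trans (ler_wpM2l (cover_weight_ge0 I N D) left_bound) _.
  apply: (le_trans ratio_bound); rewrite ler_wpM2l ?exprn_ge0 ?expR_ge0//.
  by rewrite ler_pdivlMr// mulrC.
have pow_bound : expR (s * (n%:R * tau - d.+2%:R * tau)) <= (rho / r) `^ s.
  rewrite /powR gt_eqF ?divr_gt0// ler_expR.
  apply: ler_wpM2l; first exact: ltW (le_lt_trans s'0 s's).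
  rewrite ln_div ?posrE//.
  have h1 : - (N.+1%:R * tau) <= ln rho.
    by rewrite -[leLHS]expRK -lamE ler_ln ?posrE ?exprn_gt0// ltW.
  have h2 : ln r <= - (M%:R * tau).
    by rewrite -[leRHS]expRK -lamE ler_ln ?posrE ?exprn_gt0.
  have : (N + n)%:R * tau = (M + d.+1)%:R * tau by rewrite nE.
  by rewrite !natrD -!natr1; move: h1 h2; rewrite -natr1; lra.
have Br0 := ltW Mr0; set B := ball_mass mu x r in cwN Br0 *.
apply: (le_trans upper).
have qN0 : 0 <= q ^+ (N.*2 * j.*2) by rewrite exprn_ge0// expR_ge0.
apply: (@le_trans _ _ (L%:R * (C ^+ j.*2 * q ^+ (N.*2 * j.*2) * (q ^+ n * (B / c0) / e)))).
  rewrite ler_wpM2l//; apply: ler_pM => //; [exact: exprn_ge0|exact: cover_weight_ge0].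
have G0 : 0 <= C ^+ j.*2 / c0 * B by rewrite mulr_ge0// divr_ge0// ltW.
apply: (@le_trans _ _ ((L%:R + 1) * (C ^+ j.*2 / c0 * B * (expR (n%:R * b) / e)))).
  apply: ler_pM => //; last 1 first.
  - have -> : C ^+ j.*2 * q ^+ (N.*2 * j.*2) * (q ^+ n * (B / c0) / e) =
        C ^+ j.*2 / c0 * B * (q ^+ (N.*2 * j.*2) * q ^+ n / e) by ring.
    by apply: ler_wpM2l => //; rewrite ler_pM2r ?invr_gt0.
  - apply: mulr_ge0; first exact: mulr_ge0.
    apply: divr_ge0 (ltW e0); apply: mulr_ge0; last exact: divr_ge0 (ltW c00).
    by rewrite exprn_ge0// expR_ge0.
  - by rewrite lerDl.
have -> : expR (n%:R * b) / e = expR (s * (d.+2%:R * tau) - s' * ln a) *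
    expR (s * (n%:R * tau - d.+2%:R * tau)).
  by rewrite /e -expRN -!expRD; congr expR; rewrite /b; ring.
rewrite /C2; set e2 := expR (_ - _); set e3 := expR _ in pow_bound *.
have -> : (L%:R + 1) * (C ^+ j.*2 / c0 * B * (e2 * e3)) =
  (L%:R + 1) * C ^+ j.*2 / c0 * e2 * e3 * B by ring.
apply: ler_wpM2r => //; apply: ler_wpM2l => //.
apply: mulr_ge0; last exact: expR_ge0.
by apply: divr_ge0 (ltW c00); apply: mulr_ge0 => //; rewrite addr_ge0.
Qed.

End Assouad.

Lemma lee_of_lt_EFin (R : realType) (x y : \bar R) :
  (forall s : R, (x < s%:E)%E -> (y <= s%:E)%E) -> (y <= x)%E.
Proof.
case: x => [r| |] h; [|exact: leey|].
  by apply/lee_addgt0Pr => e e0; rewrite -EFinD; apply: h; rewrite lte_fin ltrDl.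
case: y h => [s|/(_ 0)|]// h; last exact: h (ltNyr 0).
by exfalso; have := h (s - 1) (ltNyr _); rewrite lee_fin; lra.
Qed.

(** * Regular equicontractive systems are generalized regular *)

Section Equicontractive.
Context {R : realType} {m : nat}.
Variable I : weighted_ifs R m.
Variable mu : probability (measurableTypeR R) R.
Implicit Types (u w : seq 'I_m.+1) (D : R * R).
Local Notation r := (Defs.ratio I).
Local Notation pw := (word_weight I).
Local Notation rw := (word_ratio I).
Local Notation lam := (min_ratio I).
Local Notation S := (word_map I).
Local Notation E := (stopE I).
Local Notation net := (net_interval I).
Local Notation cw := (cover_weight I).
Local Notation pmin := (family_min (weight I)).

Hypothesis att : is_attractor I `[0, 1]%classic.
Hypothesis left_map : ifs_map I ord0 0 = 0.
Hypothesis right_map : ifs_map I ord_max 1 = 1.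
Hypothesis supp01 : supp mu = `[0, 1]%classic.
Hypothesis equi : equicontractive I.
Hypothesis reg : regular I.

Lemma ratioE j : r j = lam.
Proof. by rewrite /min_ratio; have [i ->] := family_min_ex r; exact: equi. Qed.

Lemma stopb_size n w : stopb I (lam ^+ n) w = (size w == n).
Proof.
have l0 := min_ratio_gt0 I; elim: n w => [|n ih] w.
  by rewrite stopb_ge1//; case: w.
have l1 : lam ^+ n.+1 < 1 by rewrite exprn_ilt1// ?min_ratio_lt1// ltW.
case: w => [|j w]; rewrite (stopb_lt1 I l1)//=.
by rewrite ratioE exprSr; have -> : lam ^+ n * lam / lam = lam ^+ n; [rewrite mulfK// gt_eqF|rewrite ih eqSS].
Qed.

Lemma pmin_gt0 : 0 < pmin.
Proof. by have [j ->] := family_min_ex (weight I); exact: weight_gt0. Qed.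

Lemma pmin_exp_le w : pmin ^+ size w <= pw w.
Proof.
elim: w => [|j w ih]; first by rewrite word_weight_nil.
rewrite word_weight_cons exprS; apply: ler_pM => //.
- exact/ltW/pmin_gt0.
- exact/exprn_ge0/ltW/pmin_gt0.
- exact: family_min_le.
Qed.

(** Each word covering D has a continuation whose cylinder contains the midpoint of D' and hence D'.
    With equal ratios it has exactly n letters, so its weight is at least the minimal weight to the
    power n. *)
Lemma cover_weight_pmin N n D D' : net N D -> net (N + n) D' ->
  D.1 <= D'.1 -> D'.2 <= D.2 -> pmin ^+ n * cw N D <= cw (N + n) D'.
Proof.
move=> nD nD' h1 h2; have D12 := net_lt nD'.
rewrite (cover_weight_markov I D' (leq_addr n N)) /cover_weight -stopEZ.
apply: ler_stopE => [|u uL]; first exact: min_ratio_exp_gt0.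
have s0 := lam_div_gt0 I (N + n) u.
case c : (covers I u D); last by rewrite mulr0; apply: stopE_ge0.
rewrite mulr1; pose x := (D'.1 + D'.2) / 2.
have x1 : D'.1 < x by rewrite /x; lra.
have x2 : x < D'.2 by rewrite /x; lra.
have [y y01 yx] : exists2 y, 0 <= y <= 1 & S u y = x.
  have : cylinder I u x.
    rewrite cylinderE /= in_itv/=; move/andP: c => [c1 c2].
    by rewrite (le_trans c1)// ?(le_trans _ c2)//; lra.
  by move=> [y]; rewrite /= in_itv/=; exists y.
have [w [ws /andP[w1 w2]]] := stopb_cover_ex att s0 y01.
have uwL : stopb I (lam ^+ (N + n)) (u ++ w) by rewrite (stopb_lam_cat _ (leq_addr n N)).
have uwD : covers I (u ++ w) D'.
  apply: (covers_net (x := x) nD' uwL); rewrite ?word_map_cat -?yx ?word_map_le//.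
  by rewrite yx x1.
have := @stopE_ge_word _ _ I _ (fun w => (covers I (u ++ w) D')%:R) w s0 _ ws.
rewrite uwD mulr1 => /(_ ltac:(by [])); apply: le_trans.
have -> : n = size w; last exact: pmin_exp_le.
move: uwL uL; rewrite !stopb_size size_cat => /eqP + /eqP uN.
by rewrite uN => /addnI.
Qed.

Lemma Q_sup_le n : (Q_sup I mu n <= (pmin ^- n)%:E)%E.
Proof.
have p0 := pmin_gt0.
apply: ge_ereal_sup => _ [x xs <-]; apply: ge_ereal_sup => _ [N [D [D' [[nD _] [nD' _] DD _ ->]]]].
have [h1 h2] := (interval_sub _ (ltW (net_lt nD'))).1 DD.
rewrite !net_weightE ?(ltW (net_lt nD))// ?(ltW (net_lt nD'))// lee_fin.
rewrite ler_pdivrMr ?(cover_weight_gt0 att nD')//.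
by rewrite mulrC ler_pdivlMr ?exprn_gt0// mulrC cover_weight_pmin.
Qed.

Lemma fixing_letter_uniq z i j : ifs_map I i z = z -> ifs_map I j z = z -> i = j.
Proof.
rewrite /ifs_map !ratioE => hi hj; apply: (@maps_distinct _ _ I).
by apply/funext => x; rewrite !ratioE; congr (_ + _); lra.
Qed.

(** As z is an extreme point of [0, 1], S_i(S_w(z)) = z forces S_w(z) = z and then S_i(z) = z. Equal
    ratios and distinct maps leave only one letter fixing z. *)
Lemma fixing_word z j w : z = 0 \/ z = 1 -> ifs_map I j z = z -> S w z = z ->
  w = nseq (size w) j.
Proof.
move=> zP jz; elim: w => //= i w ih wz.
have w01 : 0 <= S w z <= 1 by apply: word_map01 => //; case: zP => ->; rewrite lexx ler01.
have i01 : 0 <= ifs_map I i z <= 1 by apply: ifs_map01 => //; case: zP => ->; rewrite lexx ler01.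
have ri := ratio_gt0 I i.
have Swz : S w z = z.
  apply/eqP; rewrite -subr_eq0 -(mulrI_eq0 _ (mulfI (lt0r_neq0 ri))); apply/eqP.
  move: wz i01; rewrite /ifs_map.
  case: zP w01 => -> /andP[w0 w1] wz /andP[i0 i1].
    have : 0 <= r i * S w 0 by rewrite mulr_ge0// ltW.
    by lra.
  have : 0 <= r i * (1 - S w 1) by rewrite mulr_ge0 ?subr_ge0// ltW.
  by lra.
rewrite -ih//; congr (_ :: _); apply: (@fixing_letter_uniq z) => //.
by rewrite -{2}wz Swz.
Qed.

(** A path of level n has n letters here, so the only candidate is the n-th power of j. *)
Lemma edge_sum_le N D n z j (A : set (seq 'I_m.+1)) : z = 0 \/ z = 1 ->
  ifs_map I j z = z -> (forall w, A w -> is_path I N D n w /\ S w z = z) ->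
  \sum_(w \in A) pw w <= weight I j ^+ n.
Proof.
move=> zP jz AP.
have sub : A `<=` [set nseq n j].
  move=> w /AP[[u [D' [_ _ [+ _] + _]]] wz]; rewrite !LambdaE /= !stopb_size size_cat.
  by move=> /eqP uN; rewrite uN => /eqP/addnI wn; rewrite -wn; exact: (fixing_word zP jz).
have [->|->] := subset_set1 sub.
  by rewrite fsbig_set0 exprn_ge0// ltW// weight_gt0.
by rewrite fsbig_set1 /word_weight big_nseq iter_mulr_1.
Qed.

Lemma sup_edge_weight_le n : (sup_edge_weight I n <= (2 * pmin ^+ n)%:E)%E.
Proof.
have [p0 p1] := reg.
apply: ge_ereal_sup => _ [N [D [nD ->]]]; rewrite lee_fin mulr_natl mulr2n.
apply: lerD.
  by rewrite -p0; apply: (@edge_sum_le N D n 0) => //; left.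
by rewrite -p1; apply: (@edge_sum_le N D n 1) => //; right.
Qed.

Lemma equicontractive_generalized_regular : generalized_regular I mu.
Proof.
move=> q q1; have q0 : 0 < q by exact: lt_trans q1.
have p0 := pmin_gt0; have n00 := net0 left_map right_map.
(* The minimal weight to the power n cancels between the bounds for Q_n and for the edge weights. *)
have bnd n : (0%E <= Q_sup I mu n * (q ^- n)%:E * sup_edge_weight I n <= (2 * q^-1 ^+ n)%:E)%E.
  have [D [nD d1 d2]] := net_descendant att left_map right_map (leq0n n) n00.
  have Q0 : (0%E <= Q_sup I mu n)%E.
    apply: le_trans (Q_sup_ge (n := n) att supp01 n00 nD d1 d2).
    by rewrite lee_fin divr_ge0// cover_weight_ge0.
  have E0 : (0%E <= sup_edge_weight I n)%E.
    apply: (@le_trans _ _ (edge_weight I 0 (0, 1) n)%:E).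
      by rewrite lee_fin edge_weight_ge0.
    by apply: ereal_sup_ubound; exists 0%N, (0, 1).
  have qn0 : (0%E <= (q ^- n)%:E)%E by rewrite lee_fin invr_ge0 exprn_ge0// ltW.
  apply/andP; split; first by rewrite !mule_ge0.
  have -> : (2 * q^-1 ^+ n)%:E = ((pmin ^- n)%:E * (q ^- n)%:E * (2 * pmin ^+ n)%:E)%E.
    rewrite -!EFinM exprVn; congr (_%:E); field.
    by rewrite !expf_neq0// gt_eqF.
  apply: lee_pmul; rewrite ?mule_ge0 ?sup_edge_weight_le//.
  by apply: lee_wpmul2r => //; exact: Q_sup_le.
apply: (@squeeze_cvge _ _ _ _ (fun=> 0%E) _ (fun n => (2 * q^-1 ^+ n)%:E)).
- by apply: nearW => n; exact: bnd.
- exact: cvg_cst.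
- apply: cvg_EFin; first exact: nearW.
  rewrite -[0 in X in _ --> X](mulr0 2); apply: cvgMr.
  by apply: cvg_expr; rewrite ger0_norm ?invr_ge0 ?ltW// invf_lt1.
Qed.

End Equicontractive.

(** * The quasi-Assouad dimension as the maximal upper local dimension *)

Lemma generalized_regular_quasi_assouad (R : realType) (m : nat) (I : weighted_ifs R m)
    (mu : probability (measurableTypeR R) R) :
  is_attractor I `[0, 1]%classic -> ifs_map I ord0 0 = 0 -> ifs_map I ord_max 1 = 1 ->
  self_similar I mu -> supp mu = `[0, 1]%classic -> weak_separation I ->
  generalized_regular I mu ->
  is_maximum [set upper_local_dim mu x | x in supp mu] (quasi_assouad_dim mu).
Proof.
move=> att left_map right_map selfsim supp01 wsc gr.
have supp0 : supp mu 0 by rewrite supp01 /= in_itv/= lexx ler01.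
(* The exponent does not depend on delta > 0, so the limit is that of a constant, and any single
   delta bounds the local dimension at every point. *)
have expE delta : 0 < delta -> assouad_exponent mu delta = upper_local_dim mu 0.
  move=> d0; apply/le_anti; rewrite upper_local_dim_le// andbT.
  by apply: lee_of_lt_EFin => s; exact: (assouad_exponent_le att left_map right_map).
have -> : quasi_assouad_dim mu = upper_local_dim mu 0.
  apply: cvg_lim => //; apply: cvg_near_cst.
  by near=> delta; apply: expE; near: delta; exact: nbhs_right_gt.
split; first by exists 0.
move=> _ [x xs <-]; rewrite -(expE 1 ltr01).
exact: upper_local_dim_le.
Unshelve. all: by end_near. Qed.

Theorem theoremB (R : realType) (m : nat) (I : weighted_ifs R m)
    (mu : probability (measurableTypeR R) R)
    (attractor01 : is_attractor I `[0, 1]%classic)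
    (left_map : ifs_map I ord0 0 = 0)
    (right_map : ifs_map I ord_max 1 = 1)
    (self_similar_mu : self_similar I mu)
    (supp01 : supp mu = `[0, 1]%classic)
    (wsc : weak_separation I) :
  (generalized_regular I mu ->
     is_maximum [set upper_local_dim mu x | x in supp mu]
       (quasi_assouad_dim mu))
  /\
  (equicontractive I -> regular I ->
     is_maximum [set upper_local_dim mu x | x in supp mu]
       (quasi_assouad_dim mu)).
Proof.
split=> [gr|equi reg]; apply: (generalized_regular_quasi_assouad (I := I)) => //.
exact: equicontractive_generalized_regular.
Qed.
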